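(* Let $X$ be a random vector in $\mathbb{R}^n$ with an absolutely continuous distribution. Suppose that $\sqrt{\mathrm{Var}(|X|)}\leq \alpha\,\mathbb{E}|X|$ for some $\alpha\in[0,1)$. Then $$\Gamma(X)\geq C\,\frac{\sqrt{n}}{\sqrt[4]{\mathrm{Var}(|X|)}\,\sqrt{\mathbb{E}|X|}},$$ where $C=C(\alpha)>0$ depends only on $\alpha$ (in particular not on $n$ or on the distribution of $X$), and $C(\alpha)\to 0.06$ as $\alpha\to 0$, while $C(\alpha)\to 0$ as $\alpha\to 1$.
   Context: $|\cdot|$ is the Euclidean norm on $\mathbb{R}^n$ and $B_2^n$ is the closed Euclidean unit ball. For a measure $\mu$ on $\mathbb{R}^n$ and a convex set $Q\subset\mathbb{R}^n$, the $\mu$-perimeter of $Q$ is $$\mu^+(\partial Q)=\liminf_{\epsilon\to +0}\frac{\mu((Q+\epsilon B_2^n)\setminus Q)}{\epsilon}.$$ For a random vector $X$ with distribution $\mu$, $\Gamma(X)=\Gamma(\mu)=\sup_Q \mu^+(\partial Q)\in[0,\infty]$, where the supremum runs over all convex sets $Q$ in $\mathbb{R}^n$. *)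

(* Defs.v *)
From HB Require Import structures.
From mathcomp Require Import all_boot all_order all_algebra.
From mathcomp Require Import all_classical all_reals all_analysis.

Set Implicit Arguments.
Unset Strict Implicit.
Unset Printing Implicit Defensive.
Import Order.TTheory GRing.Theory Num.Theory.
Import numFieldNormedType.Exports.

Local Open Scope classical_set_scope.
Local Open Scope ring_scope.

(* R^n is 'rV[R]_n with the sigma-algebra generated by the coordinates, as the
   library does for n.-tuple R; as R is second countable, this is the Borel
   sigma-algebra of R^n. *)
Definition measure_row_display : measure_display -> measure_display.
Proof. exact. Qed.

Section measurable_row.
Context {d} {T : measurableType d} (n : nat).

Let coors : 'I_n -> 'rV[T]_n -> T := fun i x => x ord0 i.

Let row_set0 : g_sigma_preimage coors set0.
Proof. exact: sigma_algebra0. Qed.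

Let row_setC A : g_sigma_preimage coors A -> g_sigma_preimage coors (~` A).
Proof. exact: sigma_algebraC. Qed.

Let row_bigcup (F : (set 'rV[T]_n)^nat) :
  (forall i, g_sigma_preimage coors (F i)) ->
  g_sigma_preimage coors (\bigcup_i (F i)).
Proof. exact: sigma_algebra_bigcup. Qed.

HB.instance Definition _ := @isMeasurable.Build (measure_row_display d)
  'rV[T]_n (g_sigma_preimage coors) row_set0 row_setC row_bigcup.

Lemma measurable_coord (i : 'I_n) :
  measurable_fun [set: 'rV[T]_n] (fun x : 'rV[T]_n => x ord0 i).
Proof.
move=> _ Y mY; rewrite setTI; apply: sub_sigma_algebra => /=.
rewrite -bigcup_seq/=; exists i => /=; first by rewrite mem_index_enum.
by exists Y => //; rewrite setTI.
Qed.

Lemma measurable_fun_rowP d' (S : measurableType d') (f : S -> 'rV[T]_n) :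
  (forall i, measurable_fun [set: S] (fun s => f s ord0 i)) ->
  measurable_fun [set: S] f.
Proof.
move=> mf; apply: (@measurability _ _ _ _ _ _
  (\big[setU/set0]_(i < n) preimage_set_system setT (coors i) measurable)) => //.
move=> _ [B + <-]; rewrite -bigcup_seq/= => -[i _ [A mA <-]].
by rewrite setTI; apply: mf.
Qed.

End measurable_row.

Section lebesgue_row.
Context {R : realType}.

Definition row_cons n (p : R * 'rV[R]_n) : 'rV[R]_n.+1 :=
  \row_i if unlift ord0 i is Some j then p.2 ord0 j else p.1.

Definition row_uncons n (x : 'rV[R]_n.+1) : R * 'rV[R]_n :=
  (x ord0 ord0, \row_j x ord0 (lift ord0 j)).

Lemma row_consK n : cancel (@row_cons n) (@row_uncons n).
Proof.
case=> a v; rewrite /row_uncons; congr pair.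
  by rewrite mxE unlift_none.
by apply/rowP => j; rewrite !mxE liftK.
Qed.

Lemma measurable_row_cons n : measurable_fun setT (@row_cons n).
Proof.
apply: measurable_fun_rowP => i; case: (unliftP ord0 i) => [j|] ->.
  rewrite (_ : (fun s => _) = (fun x : 'rV_n => x ord0 j) \o snd).
    exact: measurableT_comp (measurable_coord j) measurable_snd.
  by apply/funext => s /=; rewrite mxE liftK.
rewrite (_ : (fun s => _) = fst); first exact: measurable_fst.
by apply/funext => s; rewrite mxE unlift_none.
Qed.

Lemma measurable_row_uncons n : measurable_fun setT (@row_uncons n).
Proof.
apply/measurable_fun_pairP; split; first exact: measurable_coord.
apply: measurable_fun_rowP => j.
rewrite (_ : (fun s => _) = (fun x : 'rV_n.+1 => x ord0 (lift ord0 j))).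
  exact: measurable_coord.
by apply/funext => s /=; rewrite mxE.
Qed.

Section step.
Local Open Scope ereal_scope.
Variables (n : nat) (m : {sigma_finite_measure set 'rV[R]_n -> \bar R}).

Definition lebesgue_cons : set 'rV[R]_n.+1 -> \bar R :=
  pushforward (@lebesgue_measure R \x m) (@row_cons n).

HB.instance Definition _ := Measure.copy lebesgue_cons
  (measure_function_pushforward__canonical__measure_function_Measure
    (@lebesgue_measure R \x m) (@measurable_row_cons n)).

Lemma sigma_finite_lebesgue_cons : sigma_finite setT lebesgue_cons.
Proof.
have /sigma_finiteP[F [TF ndF Foo]] := sigma_finiteT (@lebesgue_measure R).
have /sigma_finiteP[G [TG ndG Goo]] := sigma_finiteT m.
exists (fun k => @row_uncons n @^-1` (F k `*` G k)).
  rewrite -preimage_bigcup (_ : \bigcup_i _ = setT) ?preimage_setT//.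
  rewrite -subTset => -[x y] _.
  have [i _ Fix] : (\bigcup_i F i) x by rewrite -TF.
  have [j _ Gjy] : (\bigcup_i G i) y by rewrite -TG.
  exists (maxn i j) => //; split => /=.
    by move: x Fix; exact/subsetPset/ndF/leq_maxl.
  by move: y Gjy; exact/subsetPset/ndG/leq_maxr.
move=> k; have [mF Fk] := Foo k; have [mG Gk] := Goo k; split.
  rewrite -[X in measurable X]setTI; apply: measurable_row_uncons => //.
  exact: measurableX.
rewrite /lebesgue_cons /pushforward -comp_preimage.
rewrite (_ : _ \o _ = id); last by apply/funext => x; exact: row_consK.
by rewrite preimage_id product_measure1E// lte_mul_pinfty// ge0_fin_numE.
Qed.

HB.instance Definition _ :=
  Measure_isSigmaFinite.Build _ _ _ lebesgue_cons sigma_finite_lebesgue_cons.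

End step.

Fixpoint lebesgue_row n : {sigma_finite_measure set 'rV[R]_n -> \bar R} :=
  if n is n'.+1 then lebesgue_cons (lebesgue_row n') else \d_ (0 : 'rV[R]_0).

End lebesgue_row.

Section max_perimeter.
Context {R : realType} {n : nat}.
Implicit Types (mu : set 'rV[R]_n -> \bar R) (Q : set 'rV[R]_n).

(* The library's norm `|x| on 'rV[R]_n is the sup norm. *)
Definition enorm (x : 'rV[R]_n) : R := Num.sqrt (\sum_(i < n) x ord0 i ^+ 2).

Definition eball : set 'rV[R]_n := [set x | enorm x <= 1].

(* Q + eps B_2^n *)
Definition thickening Q (eps : R) : set 'rV[R]_n :=
  [set x + eps *: b | x in Q & b in eball].

(* A convex set need not be Borel, and a measure of the library is unspecified
   on non-measurable sets, so mu is read through its outer measure mu^*, which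
   agrees with mu on Borel sets and with its completion on completed sets. *)
Definition perimeter mu Q : \bar R :=
  limf_einf (fun eps : R => (mu^*)%mu (thickening Q eps `\` Q) * (eps^-1)%:E)%E
            0^'+.

Definition max_perimeter mu : \bar R :=
  ereal_sup [set perimeter mu Q | Q in [set Q | convex_set Q]].

End max_perimeter.

(* Main.v *)
(* Reduction to one scale.  For a convex set Q and the increasing family of its
   open neighbourhoods V_t, the lower right derivative of mu(V_t) is at most
   the perimeter of the convex set V_t, and mu(V_t) is left-continuous.  Hence
   Gamma(mu) >= mu(V_s \ Q) / s for every s > 0: no limit in the distance is
   needed, and Q may be chosen at random (Nazarov's random polytopes).

   Write m = E|X| and sigma^2 = Var|X|, and let first sigma <= m / 100.  If
   n * sigma <= 9 m, the ball of radius m - 2 sigma and Chebyshev's inequality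
   give Gamma >= 3 / (16 sigma).  Otherwise take an intersection of N half-spaces
   {<x,g_i> <= rho} with independent standard Gaussian normals g_i.  As <x,g> has
   law N(0,|x|^2), the expected measure of the points that cross exactly one facet
   within distance s is, up to a constant factor, at least s times the integral
   over mu of
     sqrt n * N * phi(rho/|x|)/|x| * Phi(rho/|x|)^(N-1),
   where the factor sqrt n is the typical length of g.  With
   rho = m * sqrt(m / (5 sigma)) and N the inverse of the Gaussian tail at
   rho / (m + 2 sigma), this density stays comparable to its maximum on the whole
   shell ||x| - m| <= 2 sigma, which has mass at least 3/4.  When
   sigma > m / 100, one random half-space (N = 1), or a ball if n <= 900, is
   enough. *)
Require Import Defs.
From HB Require Import structures.
From mathcomp Require Import all_boot all_order all_algebra.
From mathcomp Require Import all_classical all_reals all_analysis.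
From mathcomp Require Import measurable_realfun ring lra.
Import Order.TTheory GRing.Theory Num.Theory.
Import numFieldNormedType.Exports.

Set Implicit Arguments.
Unset Strict Implicit.
Unset Printing Implicit Defensive.

Local Open Scope classical_set_scope.
Local Open Scope ring_scope.

(** * Euclidean norm and neighbourhoods of convex sets *)

Section euclidean.
Context {R : realType} {n : nat}.
Implicit Types x y : 'rV[R]_n.

Definition dotr x y : R := \sum_(i < n) x ord0 i * y ord0 i.

Lemma dotrC x y : dotr x y = dotr y x.
Proof. by apply: eq_bigr => i _; rewrite mulrC. Qed.

Lemma dotrDl x y z : dotr (x + y) z = dotr x z + dotr y z.
Proof. by rewrite -big_split; apply: eq_bigr => i _; rewrite mxE mulrDl. Qed.

Lemma dotrZl (k : R) x y : dotr (k *: x) y = k * dotr x y.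
Proof. by rewrite mulr_sumr; apply: eq_bigr => i _; rewrite mxE mulrA. Qed.

Lemma dotrBl x y z : dotr (x - y) z = dotr x z - dotr y z.
Proof. by rewrite dotrDl -scaleN1r dotrZl mulN1r. Qed.

Lemma dotr_ge0 x : 0 <= dotr x x.
Proof. by apply: sumr_ge0 => i _; rewrite -expr2 sqr_ge0. Qed.

Lemma sqr_enorm x : enorm x ^+ 2 = dotr x x.
Proof.
rewrite /enorm sqr_sqrtr; last by apply: sumr_ge0 => i _; rewrite sqr_ge0.
by apply: eq_bigr => i _; rewrite expr2.
Qed.

Lemma enorm_ge0 x : 0 <= enorm x. Proof. exact: sqrtr_ge0. Qed.

Lemma enorm0 : enorm (0 : 'rV[R]_n) = 0.
Proof. by rewrite /enorm big1 ?sqrtr0// => i _; rewrite mxE expr0n. Qed.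

Lemma enormZ (k : R) x : enorm (k *: x) = `|k| * enorm x.
Proof.
apply: (@pexpIrn _ 2) => //; rewrite ?nnegrE ?mulr_ge0 ?enorm_ge0//.
by rewrite exprMn !sqr_enorm dotrZl dotrC dotrZl real_normK ?num_real// expr2 mulrA.
Qed.

Lemma enormN x : enorm (- x) = enorm x.
Proof. by rewrite -scaleN1r enormZ normrN normr1 mul1r. Qed.

(** Cauchy-Schwarz: the squared norm of |y|^2 x - <x,y> y is |y|^2 (|x|^2 |y|^2 - <x,y>^2); divide
    by |y|^2. When |y| = 0, all coordinates of y vanish. *)
Lemma dotr_le x y : dotr x y <= enorm x * enorm y.
Proof.
have [y0|y0] := eqVneq (enorm y) 0.
  rewrite y0 mulr0 /dotr big1// => i _.
  suff -> : y ord0 i = 0 by rewrite mulr0.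
  apply/eqP; rewrite -sqrf_eq0; apply/eqP.
  have := sqr_enorm y; rewrite y0 expr0n /= => /esym/eqP.
  rewrite psumr_eq0; last by move=> j _; rewrite -expr2 sqr_ge0.
  by move=> /allP/(_ i); rewrite mem_index_enum => /(_ isT) /eqP; rewrite expr2.
have yp : 0 < enorm y by rewrite lt_neqAle eq_sym y0 enorm_ge0.
have H := dotr_ge0 (enorm y ^+ 2 *: x - dotr x y *: y).
move: H; rewrite dotrBl !dotrZl ![dotr _ (_ - _)]dotrC !dotrBl !dotrZl.
rewrite (dotrC y x) -!sqr_enorm.
set X := enorm x; set Y := enorm y; set d := dotr x y => H.
have {}H : 0 <= Y ^+ 2 * ((X * Y) ^+ 2 - d ^+ 2) by rewrite (le_trans H)//; lra.
rewrite pmulr_rge0 ?exprn_gt0// subr_ge0 in H.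
have XY : 0 <= X * Y by rewrite mulr_ge0 ?enorm_ge0.
have [/le_trans->//|d0] := leP d 0.
by rewrite -(@ler_pXn2r _ 2) ?nnegrE// ltW.
Qed.

Lemma enormD x y : enorm (x + y) <= enorm x + enorm y.
Proof.
rewrite -(@ler_pXn2r _ 2) ?nnegrE ?addr_ge0 ?enorm_ge0//.
rewrite sqr_enorm dotrDl ![dotr _ (_ + _)]dotrC !dotrDl (dotrC y x) -!sqr_enorm.
by have := dotr_le x y; lra.
Qed.

Lemma enorm_le_coord (e : R) x :
  0 <= e -> (forall i, `|x ord0 i| <= e) -> enorm x <= n%:R * e.
Proof.
move=> e0 xe; rewrite -(@ler_pXn2r _ 2) ?nnegrE ?mulr_ge0 ?enorm_ge0//.
rewrite sqr_enorm (@le_trans _ _ (\sum_(i < n) e ^+ 2))//.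
  apply: ler_sum => i _; rewrite -expr2 -real_normK ?num_real//.
  by rewrite ler_pXn2r// nnegrE.
rewrite sumr_const card_ord exprMn -[leLHS]mulr_natl ler_wpM2r ?sqr_ge0//.
by rewrite -natrX ler_nat; case: (n) => // k; rewrite -{1}(expn1 k.+1) leq_pexp2l.
Qed.

(** Second countability: U is the union of the countably many boxes with rational centre and radius
    1/(j+1) that it contains. *)
Lemma measurable_coordopen (U : set 'rV[R]_n) :
  (forall x, U x -> exists2 e : R, 0 < e &
     forall y, (forall i, `|y ord0 i - x ord0 i| < e) -> U y) ->
  measurable U.
Proof.
move=> Uo.
pose box (p : 'rV[rat]_n * nat) : set 'rV[R]_n :=
  [set y | forall i, `|y ord0 i - ratr (p.1 ord0 i)| < p.2.+1%:R^-1].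
have mbox p : measurable (box p).
  rewrite (_ : box p = \bigcap_(i in [set: 'I_n])
     ((fun x : 'rV[R]_n => x ord0 i) @^-1`
        [set t : R | `|t - ratr (p.1 ord0 i)| < p.2.+1%:R^-1])); last first.
    by apply/seteqP; split => [y yp i _|y yp i]; [exact: yp|exact: (yp i)].
  apply: fin_bigcap_measurable => // i _; rewrite -[X in measurable X]setTI.
  apply: measurable_coord => //.
  rewrite (_ : [set t | _] =
     `]ratr (p.1 ord0 i) - p.2.+1%:R^-1, ratr (p.1 ord0 i) + p.2.+1%:R^-1[%classic).
    exact: measurable_itv.
  by apply/seteqP; split => t /=; rewrite in_itv/= ltr_distl.
pose F k := if @unpickle ('rV[rat]_n * nat)%type k is Some p then
   (if pselect (box p `<=` U) then box p else set0) else set0.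
rewrite (_ : U = \bigcup_k F k).
  apply: bigcupT_measurable => k; rewrite /F.
  by case: unpickle => [p|//]; case: pselect => ? /=; [exact: mbox|exact: measurable0].
apply/seteqP; split => [x Ux|x [k _]]; last first.
  by rewrite /F; case: unpickle => [p|//]; case: pselect => [H /H|].
have [e e0 eU] := Uo x Ux.
have [j je] : exists j : nat, j.+1%:R^-1 < e / 2.
  have := near_infty_natSinv_lt (PosNum (divr_gt0 e0 (ltr0Sn _ 1))).
  by case=> N _ /(_ N (leqnn N)) /= Ne; exists N.
have jp : 0 < j.+1%:R^-1 :> R by rewrite invr_gt0.
have qP i : exists q : rat, `|x ord0 i - ratr q| < j.+1%:R^-1.
  have [|q] := @rat_in_itvoo R (x ord0 i - j.+1%:R^-1) (x ord0 i + j.+1%:R^-1).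
    by rewrite ltrD2l gt0_cp.
  by rewrite in_itv /= -ltr_distl distrC => qx; exists q.
pose q : 'rV[rat]_n := \row_i projT1 (cid (qP i)).
exists (pickle (q, j)) => //; rewrite /F pickleK.
have xq : box (q, j) x by move=> i /=; rewrite mxE; exact: projT2 (cid (qP i)).
case: pselect => // -[] y yq; apply: eU => i.
rewrite (le_lt_trans (ler_distD (ratr (q ord0 i)) _ _))// (splitr e).
by rewrite ltrD// ?(lt_trans (yq i))// distrC (lt_trans (xq i)).
Qed.

End euclidean.

(** * Growth of the measure of neighbourhoods of a convex set *)

Section perimeter.
Context {R : realType} {n : nat}.
Implicit Types (Q : set 'rV[R]_n) (mu : probability 'rV[R]_n R).

(** The strict inequality makes the set Borel for every Q, and its measure left-continuous in t. *)
Definition open_nbhd Q (t : R) : set 'rV[R]_n :=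
  [set x | exists2 q, Q q & enorm (x - q) < t].

Lemma measurable_open_nbhd Q t : measurable (open_nbhd Q t).
Proof.
apply: measurable_coordopen => x [q Qq xq].
pose e := (t - enorm (x - q)) / n.+1%:R.
have e0 : 0 < e by rewrite divr_gt0// subr_gt0.
exists e => // y xy; exists q => //.
rewrite (_ : y - q = (y - x) + (x - q)); last by rewrite addrA subrK.
apply: (le_lt_trans (enormD _ _)); rewrite -ltrBrDr.
apply: (@le_lt_trans _ _ (n%:R * e)).
  by apply: enorm_le_coord => [|i]; [exact: ltW|rewrite !mxE ltW].
have : n.+1%:R * e = t - enorm (x - q) by rewrite /e mulrC divfK.
by move=> <-; rewrite ltr_pM2r// ltr_nat.
Qed.

(** The union with Q matters only for t <= 0, where the open neighbourhood is empty and the growth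
    estimate must start from Q itself. *)
Definition nbhdU Q (t : R) : set 'rV[R]_n := Q `|` open_nbhd Q t.

Lemma measurable_nbhdU Q t : measurable Q -> measurable (nbhdU Q t).
Proof. by move=> mQ; apply: measurableU => //; exact: measurable_open_nbhd. Qed.

Lemma nbhdU0 Q : nbhdU Q 0 = Q.
Proof.
apply/seteqP; split=> [x [//|[q _]]|x]; last by left.
by rewrite ltNge enorm_ge0.
Qed.

Lemma nbhdU_gt0 Q t : 0 < t -> nbhdU Q t = open_nbhd Q t.
Proof.
move=> t0; apply/seteqP; split=> [x [Qx|//]|x]; last by right.
by exists x => //; rewrite subrr enorm0.
Qed.

Lemma sub_nbhdU Q s t : s <= t -> nbhdU Q s `<=` nbhdU Q t.
Proof.
move=> st x [Qx|[q Qq xq]]; [by left|right].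
by exists q => //; exact: lt_le_trans st.
Qed.

Lemma convex_setE Q : convex_set Q <->
  (forall x y (l : R), 0 <= l <= 1 -> Q x -> Q y -> Q (l *: x + (1 - l) *: y)).
Proof.
split=> [cQ x y l /andP[l0 l1] Qx Qy|cQ x y l /set_mem Qx /set_mem Qy].
  pose k : {i01 R} := Itv01 l0 l1.
  have := cQ x y k (mem_set Qx) (mem_set Qy).
  by rewrite inE.
by apply/mem_set; apply: cQ => //; apply/andP; split; [exact: ge0|exact: le1].
Qed.

Lemma convex_nbhdU Q t : 0 <= t -> convex_set Q -> convex_set (nbhdU Q t).
Proof.
rewrite le_eqVlt => /predU1P[<-|t0]; first by rewrite nbhdU0.
rewrite nbhdU_gt0// !convex_setE => cQ x y l /andP[l0 l1] [p Qp xp] [q Qq yq].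
exists (l *: p + (1 - l) *: q); first by apply: cQ => //; rewrite l0.
rewrite (_ : _ - _ = l *: (x - p) + (1 - l) *: (y - q)); last first.
  by rewrite !scalerBr opprD addrACA.
rewrite (le_lt_trans (enormD _ _))// !enormZ ger0_norm// (ger0_norm (_ : 0 <= 1 - l)).
  2: by rewrite subr_ge0.
have [->|l0'] := eqVneq l 0; first by rewrite mul0r add0r subr0 mul1r.
have lp : 0 < l by rewrite lt_neqAle eq_sym l0'.
have -> : t = l * t + (1 - l) * t by ring.
by rewrite ltr_leD// ?ltr_pM2l// ler_wpM2l ?subr_ge0// ltW.
Qed.

(** If |x - q| < t + e, write x = q + (t + e) v with |v| < 1: then q + t v lies in the
    t-neighbourhood and e v is the remaining displacement. *)
Lemma nbhdUD_thickening Q t e : 0 <= t -> 0 < e ->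
  nbhdU Q (t + e) `<=` thickening (nbhdU Q t) e.
Proof.
move=> t0 e0 x; rewrite nbhdU_gt0 ?ltr_wpDl// => -[q Qq xq].
have te : 0 < t + e by rewrite ltr_wpDl.
pose v := (t + e)^-1 *: (x - q).
have xE : x = q + (t + e) *: v.
  by rewrite scalerA divff ?gt_eqF// scale1r addrC subrK.
have v1 : enorm v < 1.
  by rewrite enormZ ger0_norm ?invr_ge0 ?(ltW te)// mulrC ltr_pdivrMr// mul1r.
exists (q + t *: v); last first.
  exists v; first exact: ltW.
  by rewrite [in RHS]xE scalerDl addrA.
move: t0; rewrite le_eqVlt => /predU1P[<-|t0].
  by rewrite scale0r addr0; left.
right; exists q => //; rewrite addrC addKr enormZ gtr0_norm//.
by rewrite gtr_pMr.
Qed.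

(* A lower bound on the lower right Dini derivative suffices for a growth
   estimate, provided the function has no upward jump from the left. *)
Lemma dini_growth (h : R -> R) (M s : R) : 0 <= s -> 0 <= M ->
  (forall t, 0 < t <= s -> forall c, (forall u, 0 <= u < t -> h u <= c) -> h t <= c) ->
  {homo h : x y / x <= y} ->
  (forall t e, 0 <= t -> 0 < e ->
     exists2 d, 0 < d < e & h (t + d) <= h t + M * d) ->
  h s <= h 0 + M * s.
Proof.
move=> s0 M0 hl hm hd.
(* The supremum of S belongs to S because h does not jump up from the left; were it below s, the
   derivative bound would produce a larger element of S. *)
pose S := [set t | 0 <= t <= s /\ h t <= h 0 + M * t].
have S0 : S 0 by split; rewrite ?lexx ?s0// mulr0 addr0.
have hS : has_sup S by split; [exists 0|exists s => t [/andP[]]].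
have tau0 : 0 <= sup S by apply: sup_upper_bound.
have taus : sup S <= s by apply: ge_sup; [exists 0|move=> t [/andP[]]].
have Stau : h (sup S) <= h 0 + M * sup S.
  have [<-|tp] := eqVneq 0 (sup S); first by rewrite mulr0 addr0.
  apply: hl; first by rewrite lt_neqAle tp tau0.
  move=> u /andP[u0 ut].
  have [t [/andP[t0 ts] ht] utt] := sup_adherent
    (ltac:(by rewrite subr_gt0) : 0 < sup S - u) hS.
  rewrite (le_trans (hm u t _))//; first by move: utt; rewrite opprB addrCA subrr addr0 => /ltW.
  rewrite (le_trans ht)// lerD2l ler_wpM2l//.
  by apply: sup_upper_bound => //; split; rewrite ?t0.
move: taus; rewrite le_eqVlt => /predU1P[<-//|ts].
have [d /andP[d0 ds] hD] := hd (sup S) (s - sup S) tau0 ltac:(by rewrite subr_gt0).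
have : sup S + d <= sup S.
  apply: sup_upper_bound => //; split.
    by rewrite addr_ge0 ?(ltW d0)//= -lerBrDl ltW.
  by rewrite (le_trans hD)// mulrDr addrA lerD2r.
by rewrite gerDl leNgt d0.
Qed.

Lemma max_perimeter_ge mu Q : convex_set Q ->
  (perimeter mu Q <= max_perimeter mu)%E.
Proof. by move=> cQ; apply: ereal_sup_ubound; exists Q. Qed.

(** The lower limit is a supremum of infima over right neighbourhoods of 0; it is tested on the
    neighbourhood ]0, e[. *)
Lemma perimeter_lt mu Q (M e : R) : (perimeter mu Q < M%:E)%E -> 0 < e ->
  exists2 d, 0 < d < e & ((mu^*)%mu (thickening Q d `\` Q) < (M * d)%:E)%E.
Proof.
rewrite /perimeter limf_einfE => pM e0.
have Fe : (0 : R)^'+ [set d | 0 < d < e].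
  have := nbhs_right_gt (0 : R); have := nbhs_right_lt e0.
  by apply: filterS2 => d /= de d0; rewrite d0.
pose f (d : R) := ((mu^*)%mu (thickening Q d `\` Q) * (d^-1)%:E)%E.
have : (ereal_inf (f @` [set d | (0 < d < e)%R]) <=
        ereal_sup [set ereal_inf (f @` V) | V in (0 : R)^'+])%E.
  by apply: ereal_sup_ubound; exists [set d | 0 < d < e].
move=> /le_lt_trans/(_ pM).
move=> /ereal_inf_lt[_ [d /= de <-]] dM; exists d => //.
have d0 : 0 < d by case/andP: de.
by rewrite EFinM -lte_pdivrMr.
Qed.

Lemma max_perimeter_ge0 mu : (0 <= max_perimeter mu)%E.
Proof.
rewrite leNgt; apply/negP => G0.
have c0 : convex_set (set0 : set 'rV[R]_n) by move=> x y l; rewrite !inE.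
have /(perimeter_lt)/(_ ltr01)[d _] := le_lt_trans (max_perimeter_ge mu c0) G0.
by rewrite mul0r ltNge mu_ext_ge0.
Qed.

(** Each neighbourhood V_t of Q is convex, so M bounds its perimeter and hence the lower right
    derivative of mu(V_t); [dini_growth] integrates this bound from 0 to s. *)
Lemma perimeter_growth mu Q (M s : R) : convex_set Q -> measurable Q -> 0 <= s ->
  (max_perimeter mu <= M%:E)%E -> (mu (nbhdU Q s `\` Q) <= (M * s)%:E)%E.
Proof.
move=> cQ mQ s0 GM.
have M0 : 0 <= M by rewrite -lee_fin (le_trans _ GM)// max_perimeter_ge0.
pose h t := fine (mu (nbhdU Q t)).
have hE t : mu (nbhdU Q t) = (h t)%:E.
  by rewrite fineK// fin_num_measure//; exact: measurable_nbhdU.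
have hD t u : u <= t -> mu (nbhdU Q t `\` nbhdU Q u) = (h t - h u)%:E.
  move=> ut; rewrite measureD; last 3 first.
  - exact: measurable_nbhdU.
  - exact: measurable_nbhdU.
  - by rewrite /= hE ltry.
  by rewrite setIidr; [rewrite EFinB -!hE|exact: sub_nbhdU].
have hm : {homo h : x y / x <= y}.
  move=> x y xy; rewrite -lee_fin -!hE le_measure ?inE//;
    [exact: measurable_nbhdU|exact: measurable_nbhdU|exact: sub_nbhdU].
have hl t : 0 < t <= s -> forall c, (forall u, 0 <= u < t -> h u <= c) -> h t <= c.
  move=> /andP[t0 ts] c hc.
  (* These radii increase to t, and continuity of mu from below excludes an upward jump at t. *)
  pose u k := Num.max 0 (t - k.+1%:R^-1).
  have ut k : 0 <= u k < t.
    by rewrite le_max lexx/= gt_max t0 ltrBlDr ltrDl invr_gt0 ltr0Sn.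
  have UE : \bigcup_k nbhdU Q (u k) = nbhdU Q t.
    apply/seteqP; split=> [x [k _]|x].
      by apply: sub_nbhdU; case/andP: (ut k) => _ /ltW.
    case=> [Qx|[q Qq xq]]; first by exists 0%N => //; left.
    have := near_infty_natSinv_lt (PosNum (ltac:(by rewrite subr_gt0) : 0 < t - enorm (x - q))).
    case=> N _ /(_ N (leqnn N)) /= Ne; exists N => //; right; exists q => //.
    by rewrite /u lt_max; apply/orP; right; rewrite ltrBrDl -ltrBrDr.
  have := @nondecreasing_cvg_mu _ _ _ mu (fun k => nbhdU Q (u k)).
  rewrite UE => /(_ (fun k => measurable_nbhdU (u k) mQ) (measurable_nbhdU t mQ)).
  have nd : nondecreasing_seq (fun k => nbhdU Q (u k)).
    move=> i j ij; apply/subsetPset; apply: sub_nbhdU.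
    rewrite /u ge_max le_max lexx/= le_max; apply/orP; right.
    by rewrite lerD2l lerN2 lef_pV2 ?posrE// ler_nat.
  move=> /(_ nd) cv; rewrite -lee_fin -hE -(cvg_lim _ cv)//.
  apply: lime_le; first by apply/cvg_ex; eexists; exact: cv.
  by apply: nearW => k /=; rewrite hE lee_fin hc.
(* A lower limit at most M gives small difference quotients only below a strictly larger M'; the
   slack is removed at the end. *)
have hd M' : M < M' -> forall t e, 0 <= t -> 0 < e ->
     exists2 d, 0 < d < e & h (t + d) <= h t + M' * d.
  move=> MM' t e t0 e0.
  have ct := convex_nbhdU t0 cQ.
  have /(perimeter_lt)/(_ e0)[d de dM] : (perimeter mu (nbhdU Q t) < M'%:E)%E.
    rewrite (le_lt_trans (max_perimeter_ge mu ct))// (le_lt_trans GM)//.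
  exists d => //; have d0 : 0 < d by case/andP: de.
  have mD : measurable (nbhdU Q (t + d) `\` nbhdU Q t).
    by apply: measurableD; exact: measurable_nbhdU.
  rewrite -lerBlDl -lee_fin -hD ?lerDl ?(ltW d0)//.
  rewrite -measurable_mu_extE// (le_trans _ (ltW dM))//.
  by apply: le_mu_ext; apply: setSD; exact: nbhdUD_thickening.
have key : h s <= h 0 + M * s.
  apply/ler_addgt0Pr => e e0.
  (* The slack costs at most e over the length s; dividing by s + 1 instead of s covers s = 0. *)
  pose M' := M + e / (s + 1).
  have s1 : 0 < s + 1 by rewrite ltr_wpDl.
  have := @dini_growth h M' s s0 _ hl hm (hd M' _).
  have e1 : 0 < e / (s + 1) by rewrite divr_gt0.
  move=> /(_ ltac:(by rewrite /M' addr_ge0// ltW) ltac:(by rewrite /M' ltrDl)) hs.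
  rewrite (le_trans hs)// -addrA lerD2l /M' mulrDl lerD2l mulrAC.
  by rewrite ler_pdivrMr// ler_pM2l// lerDl.
by rewrite -{2}[Q]nbhdU0 hD// lee_fin lerBlDl.
Qed.

End perimeter.

(** * Gaussian integrals *)

Section ge0_integralZT.
Context {d} {T : measurableType d} {R : realType} (mu : {measure set T -> \bar R}).
Variables (f : T -> \bar R) (k : \bar R).
Hypotheses (mf : measurable_fun setT f) (f0 : forall x, (0 <= f x)%E).
Hypothesis k0 : (0 <= k)%E.

Lemma ge0_integralZlT : (\int[mu]_x (k * f x) = k * \int[mu]_x f x)%E.
Proof. by rewrite ge0_integralZl. Qed.

Lemma ge0_integralZrT : (\int[mu]_x (f x * k) = \int[mu]_x f x * k)%E.
Proof. by rewrite muleC -ge0_integralZlT; apply: eq_integral => x _; rewrite muleC. Qed.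

End ge0_integralZT.

(** * Affine change of variable on the line *)

Section affine.
Context {R : realType}.
Notation leb := (@lebesgue_measure R).
Variables (k b : R).
Hypothesis k0 : 0 < k.

Definition affine (t : measurableTypeR R) : measurableTypeR R := k * t + b.

Lemma measurable_affine : measurable_fun setT affine.
Proof. by apply: measurable_funD => //; apply: measurable_funM. Qed.

Lemma affine_preimage (u v : R) :
  affine @^-1` `]u, v] = `](u - b) / k, (v - b) / k]%classic.
Proof.
apply/seteqP; split => t; rewrite /affine /= !in_itv/=.
  by move=> /andP[ut tv]; rewrite ltr_pdivrMr// ler_pdivlMr// (mulrC t) ltrBlDr ut lerBrDr.
by rewrite ltr_pdivrMr// ler_pdivlMr// (mulrC t) ltrBlDr lerBrDr.
Qed.

Definition affine_measure : {measure set (measurableTypeR R) -> \bar R} :=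
  mscale (NngNum (ltW k0))
    (measure_function_pushforward__canonical__measure_function_Measure
      leb measurable_affine).

(** The two measures agree on the intervals ]u, v], which determine Lebesgue measure. *)
Lemma lebesgue_affine A : measurable A -> leb A = affine_measure A.
Proof.
move=> mA; apply: (lebesgue_measure_unique (mu := affine_measure)) => //.
move=> _ [[u v]] _ <-.
rewrite (_ : affine_measure _ = (k%:E * leb (affine @^-1` `]u, v]))%E)//.
rewrite affine_preimage !lebesgue_measure_itv/=.
rewrite !lte_fin ltr_pM2r ?invr_gt0// ltrD2r; case: ifPn => _; last by rewrite mule0.
by rewrite -!EFinB -EFinM; congr EFin; field; rewrite gt_eqF.
Qed.

Lemma integral_affine (f : R -> \bar R) :
  measurable_fun setT f -> (forall x, 0 <= f x)%E ->
  (\int[leb]_x f x = k%:E * \int[leb]_x f (k * x + b)%R)%E.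
Proof.
move=> mf f0.
transitivity (\int[affine_measure]_x f x)%E.
  by apply: eq_measure_integral => A mA _; apply: lebesgue_affine.
rewrite ge0_integral_mscale//; congr (_ * _)%E.
rewrite (@ge0_integral_pushforward _ _ _ _ _ _ measurable_affine)//=.
Qed.

End affine.

(** * Gaussian weights on the line, in the plane and in R^n *)

Section gauss.
Context {R : realType}.
Notation leb := (@lebesgue_measure R :
  {sigma_finite_measure set (measurableTypeR R) -> \bar R}).
Variable a : R.
Hypothesis a0 : 0 < a.

Definition gw (t : R) : R := expR (- (a * t ^+ 2)).

(** The integral of e^(-a t^2) over the line; for a = 1/2 it is sqrt(2 pi). *)
Definition gJ : R := Num.sqrt (pi / a).

Lemma gJ_gt0 : 0 < gJ.
Proof. by rewrite sqrtr_gt0 divr_gt0// pi_gt0. Qed.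

Lemma gw_ge0 t : 0 <= gw t. Proof. exact: expR_ge0. Qed.

Lemma measurable_gw : measurable_fun setT gw.
Proof.
apply: measurableT_comp => //; apply: measurableT_comp => //.
by apply: measurable_funM => //; exact: measurable_funX.
Qed.

(** The integrand is [gJ] times the normal density of mean c and variance 1/(2a). *)
Lemma integral_gw_shift (c : R) : (\int[leb]_t (gw (t - c))%:E = gJ%:E)%E.
Proof.
pose s := Num.sqrt (2 * a)^-1.
have a2 : 0 < 2 * a by rewrite mulr_gt0.
have s0 : s != 0 by rewrite gt_eqF// sqrtr_gt0 invr_gt0.
have s2 : s ^+ 2 = (2 * a)^-1 by rewrite sqr_sqrtr// ltW// invr_gt0.
have pE : normal_peak s = gJ^-1.
  rewrite /normal_peak /gJ s2 -mulr_natr; congr (_^-1); congr Num.sqrt.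
  by field; rewrite gt_eqF.
rewrite -[RHS]mule1 -(integral_normal_pdf c s) -ge0_integralZl//; last 3 first.
- by apply/measurable_EFinP; exact: measurable_normal_pdf.
- by move=> t _; rewrite lee_fin normal_pdf_ge0.
- by rewrite lee_fin ltW ?gJ_gt0.
apply: eq_integral => t _; rewrite -EFinM normal_pdfE// pE mulrA divff ?mul1r.
  2: by rewrite gt_eqF ?gJ_gt0.
rewrite /gw /normal_fun s2; congr (expR _)%:E.
by rewrite -(mulr_natr (_^-1)); field; rewrite gt_eqF.
Qed.

Lemma integral_gw : (\int[leb]_t (gw t)%:E = gJ%:E)%E.
Proof.
by rewrite -(integral_gw_shift 0); apply: eq_integral => t _; rewrite subr0.
Qed.

Lemma integralN (f : R -> \bar R) :
  measurable_fun setT f -> (forall x, 0 <= f x)%E ->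
  (\int[leb]_x f (- x)%R = \int[leb]_x f x)%E.
Proof.
move=> mf f0.
have mN : measurable_fun setT (-%R : measurableTypeR R -> measurableTypeR R) by [].
transitivity (\int[pushforward leb (-%R : measurableTypeR R -> measurableTypeR R)]_x f x)%E.
  by rewrite (@ge0_integral_pushforward _ _ _ _ _ _ mN).
by apply: eq_measure_integral => A mA _; exact: lebesgue_measureN.
Qed.

(* Rotation invariance of the Gaussian weight in the plane, obtained by
   completing the square. *)
Lemma integral_gw2 (b c : R) (f : R -> \bar R) : 0 <= c ->
  measurable_fun setT f -> (forall x, 0 <= f x)%E ->
  (\int[leb]_t (\int[leb]_y (f (b * t + c * y)%R * (gw y)%:E) * (gw t)%:E) =
   gJ%:E * \int[leb]_z (f (Num.sqrt (b ^+ 2 + c ^+ 2) * z)%R * (gw z)%:E))%E.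
Proof.
move=> c0 mf f0.
have mgw := measurable_gw.
have mfl (d : R) : measurable_fun setT (fun t : R => f (d * t)%R).
  by apply: measurableT_comp => //; exact: measurable_funM.
have mEgw : measurable_fun setT (EFin \o gw) by exact/measurable_EFinP.
have J0 : (0 <= gJ%:E)%E by rewrite lee_fin ltW// gJ_gt0.
have fgw0 (d t : R) : (0 <= f (d * t)%R * (gw t)%:E)%E by rewrite mule_ge0// lee_fin gw_ge0.
have mfgw (d : R) : measurable_fun setT (fun t : R => f (d * t)%R * (gw t)%:E)%E.
  exact: emeasurable_funM.
(* For c = 0 the variables separate, and a negative b is turned into -b by reflecting t. *)
move: c0; rewrite le_eqVlt => /predU1P[<-|c0].
  transitivity (\int[leb]_t (gJ%:E * (f (b * t)%R * (gw t)%:E)))%E.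
    apply: eq_integral => t _.
    under eq_integral do rewrite mul0r addr0.
    rewrite ge0_integralZlT//; last by move=> y; rewrite lee_fin gw_ge0.
    by rewrite integral_gw (muleC (f _)) muleA.
  rewrite ge0_integralZlT//; last exact: mfgw.
  congr (_ * _)%E; rewrite expr0n/= addr0 sqrtr_sqr; have [b0|b0] := ger0P b => //.
  rewrite -(integralN (mfgw (- b)) (fgw0 (- b))).
  by apply: eq_integral => t _; rewrite mulNr mulrN opprK /gw sqrrN.
pose d := Num.sqrt (b ^+ 2 + c ^+ 2).
have d2 : d ^+ 2 = b ^+ 2 + c ^+ 2.
  by rewrite sqr_sqrtr// addr_ge0// sqr_ge0.
have d0 : 0 < d by rewrite sqrtr_gt0 ltr_wpDl ?sqr_ge0// exprn_gt0.
have dc0 : 0 < d / c by rewrite divr_gt0.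
(* With y = (d z - b t)/c, the argument b t + c y becomes d z, and t^2 + y^2 = z^2 + ((d t - b
   z)/c)^2. [G] is the integrand in the variables (t, z). *)
pose G (p : R * R) : \bar R :=
  (f (d * p.2)%R * (gw p.2 * gw (d / c * p.1 + - (b * p.2 / c)))%:E)%E.
have mG : measurable_fun setT G.
  apply: emeasurable_funM; first exact: (measurableT_comp (mfl d)).
  apply/measurable_EFinP/measurable_funM; first exact: measurableT_comp.
  apply: measurableT_comp => //; apply: measurable_funD.
    exact: measurable_funM.
  by apply: measurable_funN; do 2 apply: measurable_funM => //.
have G0 p : (0 <= G p)%E by rewrite mule_ge0// lee_fin mulr_ge0 ?gw_ge0.
transitivity (\int[leb]_t ((d / c)%:E * \int[leb]_z G (t, z)))%E.
  apply: eq_integral => t _.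
  have mH : measurable_fun setT (fun y : R => f (b * t + c * y)%R * (gw y)%:E)%E.
    apply: emeasurable_funM => //; apply: measurableT_comp => //.
    by apply: measurable_funD => //; exact: measurable_funM.
  have H0 (y : R) : (0 <= f (b * t + c * y)%R * (gw y)%:E)%E.
    by rewrite mule_ge0// lee_fin gw_ge0.
  rewrite (integral_affine (- (b * t / c)) dc0 mH H0) -muleA; congr (_ * _)%E.
  rewrite -ge0_integralZrT//; last 2 first.
  - apply: (measurableT_comp mH).
    by apply: measurable_funD => //; exact: measurable_funM.
  - by rewrite lee_fin gw_ge0.
  apply: eq_integral => z _; rewrite /G/= -muleA -EFinM; congr (f _ * _%:E)%E.
    by field; rewrite gt_eqF.
  rewrite /gw -!expRD; congr expR.
  rewrite -!opprD -!mulrDr; congr (- (a * _)).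
  have -> : (d / c * z - b * t / c) ^+ 2 + t ^+ 2 =
     (d ^+ 2 * z ^+ 2 - 2 * d * b * z * t + (b ^+ 2 + c ^+ 2) * t ^+ 2) / c ^+ 2.
    by field; rewrite gt_eqF.
  have -> : z ^+ 2 + (d / c * t + - (b * z / c)) ^+ 2 =
     ((b ^+ 2 + c ^+ 2) * z ^+ 2 - 2 * d * b * z * t + d ^+ 2 * t ^+ 2) / c ^+ 2.
    by field; rewrite gt_eqF.
  by rewrite d2.
rewrite ge0_integralZlT//; last 3 first.
- exact: measurable_fun_fubini_tonelli_F.
- by move=> t; apply: integral_ge0.
- by rewrite lee_fin ltW.
rewrite fubini_tonelli//.
(* Integrating over t first leaves a shifted Gaussian in (d/c) t, whose factor c/d cancels the
   Jacobian d/c. *)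
transitivity ((d / c)%:E * \int[leb]_z ((gJ * (c / d))%:E * (f (d * z)%R * (gw z)%:E)))%E.
  congr (_ * _)%E; apply: eq_integral => z _.
  have := integral_affine (- (b * z / c)) dc0 mEgw
    (fun t => ltac:(by rewrite lee_fin gw_ge0)).
  rewrite integral_gw /= => JE.
  rewrite [RHS]muleC; under eq_integral do rewrite /G /= EFinM muleA.
  rewrite ge0_integralZlT//; last 2 first.
  - apply: (measurableT_comp mEgw).
    by apply: measurable_funD => //; exact: measurable_funM.
  - by move=> t; rewrite lee_fin gw_ge0.
  congr (_ * _)%E; rewrite EFinM JE muleAC -EFinM.
  by rewrite (_ : d / c * (c / d) = 1) ?mul1e//; field; rewrite !gt_eqF.
rewrite ge0_integralZlT; last 3 first.
- exact: mfgw.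
- exact: fgw0.
- by rewrite lee_fin mulr_ge0 ?divr_ge0 ?ltW ?gJ_gt0.
rewrite muleA -EFinM (_ : d / c * (gJ * (c / d)) = gJ)//.
by field; rewrite !gt_eqF.
Qed.

Lemma measurable_dotr n (x : 'rV[R]_n) : measurable_fun setT (dotr x).
Proof.
apply: measurable_sum => i; apply: measurable_funM => //.
exact: measurable_coord.
Qed.

Lemma measurable_dotrr n : measurable_fun setT (fun x : 'rV[R]_n => dotr x x).
Proof.
by apply: measurable_sum => i; apply: measurable_funM; exact: measurable_coord.
Qed.

Lemma dotr_row_cons n (x : 'rV[R]_n.+1) (p : R * 'rV[R]_n) :
  dotr x (row_cons p) = x ord0 ord0 * p.1 + dotr (row_uncons x).2 p.2.
Proof.
rewrite /dotr big_ord_recl !mxE unlift_none; congr (_ + _).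
by apply: eq_bigr => i _; rewrite !mxE liftK.
Qed.

Lemma dotr_row_cons2 n (p : R * 'rV[R]_n) :
  dotr (row_cons p) (row_cons p) = p.1 ^+ 2 + dotr p.2 p.2.
Proof. by rewrite dotr_row_cons row_consK mxE unlift_none expr2. Qed.

Lemma enorm_row_uncons n (x : 'rV[R]_n.+1) :
  enorm x = Num.sqrt (x ord0 ord0 ^+ 2 + enorm (row_uncons x).2 ^+ 2).
Proof.
rewrite sqr_enorm /enorm big_ord_recl; congr (Num.sqrt (_ + _)).
by apply: eq_bigr => i _; rewrite mxE expr2.
Qed.

Definition gwr n (g : 'rV[R]_n) : R := expR (- (a * dotr g g)).

Lemma gwr_ge0 n (g : 'rV[R]_n) : 0 <= gwr g. Proof. exact: expR_ge0. Qed.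

Lemma measurable_gwr n : measurable_fun setT (@gwr n).
Proof.
apply: measurableT_comp => //; apply: measurableT_comp => //.
by apply: measurable_funM => //; exact: measurable_dotrr.
Qed.

Lemma integral_row_cons n (F : 'rV[R]_n.+1 -> \bar R) :
  measurable_fun setT F -> (forall x, 0 <= F x)%E ->
  (\int[lebesgue_row n.+1]_x F x =
   \int[leb]_t \int[lebesgue_row n]_y F (row_cons (t, y)))%E.
Proof.
move=> mF F0.
transitivity (\int[pushforward (leb \x lebesgue_row n)%E (@row_cons R n)]_x F x)%E.
  by [].
have mFc : measurable_fun setT (F \o @row_cons R n).
  by apply: measurableT_comp => //; exact: measurable_row_cons.
transitivity (\int[(leb \x lebesgue_row n)%E]_p (F \o @row_cons R n) p)%E; last first.
  exact: (fubini_tonelli1 (m1 := leb) (m2 := lebesgue_row n) _ mFc (fun p => F0 _)).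
pose m : {measure set (measurableTypeR R * 'rV[R]_n)%type -> \bar R} :=
  (leb \x lebesgue_row n)%E.
have mc : measurable_fun [set: (measurableTypeR R * 'rV[R]_n)%type] (@row_cons R n).
  exact: measurable_row_cons.
have := ge0_integral_pushforward mc m measurableT mF (fun x _ => F0 x).
by rewrite preimage_setT.
Qed.

(** Induction on the dimension: splitting off one coordinate leaves a planar integral of f(x_0 t +
    |x'| y), which [integral_gw2] turns into one of f(|x| z). The factor [gJ] on the left avoids the
    exponent n - 1, so that n = 0 is covered. *)
Lemma integral_gwr n (x : 'rV[R]_n) (f : R -> \bar R) :
  measurable_fun setT f -> (forall x, 0 <= f x)%E ->
  (gJ%:E * \int[lebesgue_row n]_g (f (dotr x g) * (gwr g)%:E) =
   (gJ ^+ n)%:E * \int[leb]_y (f (enorm x * y)%R * (gw y)%:E))%E.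
Proof.
elim: n x f => [|n IH] x f mf f0.
  rewrite expr0 mul1e integral_dirac//; last first.
    apply: emeasurable_funM; last by apply/measurable_EFinP; exact: measurable_gwr.
    by apply: (measurableT_comp mf); exact: measurable_dotr.
  rewrite diracT mul1e /dotr /gwr /dotr !big_ord0 mulr0 oppr0 expR0 mule1.
  rewrite /enorm big_ord0 sqrtr0; under eq_integral do rewrite mul0r.
  rewrite ge0_integralZlT; last 3 first.
  - by apply/measurable_EFinP; exact: measurable_gw.
  - by move=> y; rewrite lee_fin gw_ge0.
  - exact: f0.
  by rewrite integral_gw muleC.
have mg k : measurable_fun setT (fun g : 'rV[R]_k => (gwr g)%:E).
  by apply/measurable_EFinP; exact: measurable_gwr.
have mw : measurable_fun setT (fun t : R => (gw t)%:E).
  by apply/measurable_EFinP; exact: measurable_gw.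
have J0 : (0 <= gJ%:E)%E by rewrite lee_fin ltW// gJ_gt0.
have mft (t : R) : measurable_fun setT (fun s : R => f (x ord0 ord0 * t + s)%R).
  by apply: measurableT_comp => //; exact: measurable_funD.
set x' := (row_uncons x).2.
have mfg : measurable_fun setT (fun g => f (dotr x g) * (gwr g)%:E)%E.
  apply: emeasurable_funM; last exact: mg.
  by apply: (measurableT_comp mf); exact: measurable_dotr.
have fg0 g : (0 <= f (dotr x g) * (gwr g)%:E)%E by rewrite mule_ge0// lee_fin gwr_ge0.
rewrite integral_row_cons// -ge0_integralZlT//; last 2 first.
- have mfgc : measurable_fun setT ((fun g => f (dotr x g) * (gwr g)%:E)%E \o @row_cons R n).
    by apply: measurableT_comp => //; exact: measurable_row_cons.
  exact: (measurable_fun_fubini_tonelli_F _ mfgc (fun p => fg0 _)).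
- by move=> t; apply: integral_ge0.
transitivity (\int[leb]_t ((gJ ^+ n)%:E * (\int[leb]_y
    (f (x ord0 ord0 * t + enorm x' * y)%R * (gw y)%:E) * (gw t)%:E)))%E.
  apply: eq_integral => t _; rewrite muleA -(IH x' _ (mft t)) -?muleA//; congr (_ * _)%E.
  rewrite -ge0_integralZrT; last 3 first.
  - apply: emeasurable_funM; last exact: mg.
    by apply: (measurableT_comp (mft t)); exact: measurable_dotr.
  - by move=> y; rewrite mule_ge0// lee_fin gwr_ge0.
  - by rewrite lee_fin gw_ge0.
  apply: eq_integral => y _; rewrite dotr_row_cons -muleA; congr (_ * _)%E.
  by rewrite /gwr dotr_row_cons2 mulrDr opprD addrC expRD EFinM.
rewrite ge0_integralZlT; last 3 first.
- apply: emeasurable_funM; last exact: mw.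
  have mF2 : measurable_fun setT (fun p : R * R =>
      f (x ord0 ord0 * p.1 + enorm x' * p.2)%R * (gw p.2)%:E)%E.
    apply: emeasurable_funM; last exact: (measurableT_comp mw).
    apply: (measurableT_comp mf).
    by apply: measurable_funD; apply: measurable_funM.
  have F20 p : (0 <= f (x ord0 ord0 * p.1 + enorm x' * p.2)%R * (gw p.2)%:E)%E.
    by rewrite mule_ge0// lee_fin gw_ge0.
  exact: (measurable_fun_fubini_tonelli_F (m2 := leb) _ mF2 F20).
- move=> t; apply: mule_ge0; last by rewrite lee_fin gw_ge0.
  by apply: integral_ge0 => y _; rewrite mule_ge0// lee_fin gw_ge0.
- by rewrite lee_fin exprn_ge0// ltW// gJ_gt0.
rewrite integral_gw2 ?enorm_ge0// muleA -EFinM -exprSr.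
by rewrite -enorm_row_uncons.
Qed.

End gauss.

(** * Gaussian mass of slabs, shells and half-spaces *)

Section gauss_estimates.
Context {R : realType}.
Notation leb := (@lebesgue_measure R :
  {sigma_finite_measure set (measurableTypeR R) -> \bar R}).

Notation J := (gJ (2^-1 : R)).

Lemma gJ_half (a : R) : 0 < a -> gJ a = Num.sqrt (2 * a)^-1 * J.
Proof.
move=> a0; rewrite /gJ -sqrtrM ?invr_ge0 ?mulr_ge0 ?ltW//; congr Num.sqrt.
by field; rewrite gt_eqF.
Qed.

Lemma integral_gwr_div (a : R) n (x : 'rV[R]_n) (f : R -> \bar R) : 0 < a ->
  measurable_fun setT f -> (forall t, 0 <= f t)%E ->
  (\int[lebesgue_row n]_g (f (dotr x g) * (gwr a g)%:E) =
   (gJ a ^+ n / gJ a)%:E * \int[leb]_y (f (enorm x * y)%R * (gw a y)%:E))%E.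
Proof.
move=> a0 mf f0; have J0 := gJ_gt0 a0.
rewrite mulrC EFinM -muleA -(integral_gwr a0)// muleA -EFinM mulVf ?gt_eqF//.
by rewrite mul1e.
Qed.

Lemma integral_gwr1 n (a : R) : 0 < a ->
  (\int[lebesgue_row n]_g (gwr a g)%:E = (gJ a ^+ n)%:E)%E.
Proof.
move=> a0; have J0 := gJ_gt0 a0.
have := @integral_gwr_div a n 0 (cst 1%E) a0 (measurable_cst _) (fun=> lee01).
under eq_integral do rewrite mul1e.
under [in RHS]eq_integral do rewrite mul1e.
by rewrite (integral_gw a0) -EFinM divfK ?gt_eqF.
Qed.

Lemma gw_le (a s t : R) : 0 < a -> 0 <= s -> s <= t -> gw a t <= gw a s.
Proof.
move=> a0 s0 st; rewrite ler_expR lerN2 ler_pM2l// ler_pXn2r// nnegrE//.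
exact: le_trans st.
Qed.

Section interval.
Variables (a r u v : R).
Hypotheses (a0 : 0 < a) (r0 : 0 < r) (u0 : 0 <= u) (uv : u <= v).

Let I : set R := `]u / r, v / r[%classic.

Let ur0 : 0 <= u / r. Proof. by rewrite divr_ge0// ltW. Qed.

Let mI : measurable I. Proof. exact: measurable_itv. Qed.

Let m1I : measurable_fun setT (\1_I : R -> R).
Proof. exact: measurable_indic. Qed.

Let int_indic (c : R) : 0 <= c ->
  (\int[leb]_y ((\1_I y * c)%:E) = ((v - u) / r * c)%:E)%E.
Proof.
move=> c0; under eq_integral do rewrite EFinM.
rewrite ge0_integralZrT; last 3 first.
- exact/measurable_EFinP.
- by move=> y; rewrite lee_fin.
- by rewrite lee_fin.
transitivity (lebesgue_measure I * c%:E)%E.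
  by rewrite integral_indic// setIT.
rewrite /I lebesgue_measure_itv/= lte_fin ltr_pM2r ?invr_gt0//; case: ltP => // vu.
  by rewrite (mulrBl r^-1 v u).
have -> : u = v by apply/le_anti; rewrite uv.
by rewrite subrr !mul0r mul0e.
Qed.

Let scaleI y : \1_(`]u, v[%classic) (r * y) = \1_I y :> R.
Proof.
rewrite !indicE; congr (_%:R); apply: congr1.
by apply/idP/idP; rewrite !inE /I /= !in_itv/= ltr_pdivrMr// ltr_pdivlMr// mulrC.
Qed.

Let mIgw : measurable_fun setT
  (fun y : R => (\1_(`]u, v[%classic) (r * y)%R)%:E * (gw a y)%:E)%E.
Proof.
under eq_fun do rewrite scaleI -EFinM.
by apply/measurable_EFinP/measurable_funM => //; exact: measurable_gw.
Qed.

Let mIc (c : R) : measurable_fun setT (fun y : R => (\1_I y * c)%:E).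
Proof. by apply/measurable_EFinP/measurable_funM. Qed.

(** The weight decreases on the positive half-line, so its value at the right end is a lower bound
    on an interval of length (v - u)/r. The companion upper bound uses the left end. *)
Lemma integral_gw_itv_ge :
  (((v - u) / r * gw a (v / r))%:E <=
   \int[leb]_y ((\1_(`]u, v[%classic) (r * y)%R)%:E * (gw a y)%:E))%E.
Proof.
rewrite -int_indic ?gw_ge0//; apply: ge0_le_integral => //.
- by move=> y _; rewrite lee_fin mulr_ge0 ?gw_ge0.
- exact: mIc.
- move=> y _; rewrite scaleI -EFinM lee_fin indicE.
  case: (boolP (y \in I)); last by rewrite !mul0r.
  rewrite inE /I/= in_itv/= !mul1r => /andP[uy yv].
  by apply: gw_le => //; [exact: le_trans (ltW uy)|exact: ltW].
Qed.

Lemma integral_gw_itv_le :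
  (\int[leb]_y ((\1_(`]u, v[%classic) (r * y)%R)%:E * (gw a y)%:E) <=
   ((v - u) / r * gw a (u / r))%:E)%E.
Proof.
rewrite -int_indic ?gw_ge0//; apply: ge0_le_integral => //.
- by move=> y _; rewrite -EFinM lee_fin mulr_ge0 ?gw_ge0.
- exact: mIc.
- move=> y _; rewrite scaleI -EFinM lee_fin indicE.
  case: (boolP (y \in I)); last by rewrite !mul0r.
  rewrite inE /I/= in_itv/= !mul1r => /andP[uy yv].
  by apply: gw_le => //; exact: ltW.
Qed.

End interval.

(** Mills' upper bound phi(v)/v for the standard Gaussian tail beyond v, not the tail itself. *)
Definition gtail (v : R) : R := gw 2^-1 v / (J * v).

(** After the shift by v, (y + v)^2 >= v^2 + 2 v y bounds the weight by e^(-v^2/2) e^(-v y), a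
    multiple of the exponential density of rate v. *)
Lemma integral_gw_tail (v : R) : 0 < v ->
  (\int[leb]_y ((\1_(`]v, +oo[%classic) y)%:E * (gw 2^-1 y)%:E) <=
   (gw 2^-1 v / v)%:E)%E.
Proof.
move=> v0.
have mf : measurable_fun setT
    (fun y : R => (\1_(`]v, +oo[%classic) y)%:E * (gw 2^-1 y)%:E)%E.
  apply: emeasurable_funM; apply/measurable_EFinP; last exact: measurable_gw.
  by apply: measurable_indic; exact: measurable_itv.
have f0 (y : R) : (0 <= (\1_(`]v, +oo[%classic) y)%:E * (gw 2^-1 y)%:E)%E.
  by rewrite -EFinM lee_fin mulr_ge0 ?gw_ge0.
rewrite (integral_affine v ltr01 mf f0) mul1e.
have -> : (gw 2^-1 v / v)%:E = (\int[leb]_y ((gw 2^-1 v / v)%:E * (exponential_pdf v y)%:E))%E.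
  rewrite ge0_integralZlT ?integral_exponential_pdf ?mule1//.
  - by apply/measurable_EFinP; exact: measurable_exponential_pdf.
  - by move=> y; rewrite lee_fin exponential_pdf_ge0// ltW.
  - by rewrite lee_fin divr_ge0 ?gw_ge0// ltW.
apply: ge0_le_integral => //.
- apply: (measurableT_comp mf).
  by apply: measurable_funD => //; exact: measurable_funM.
- by apply: emeasurable_funM => //; apply/measurable_EFinP; exact: measurable_exponential_pdf.
move=> y _; rewrite mul1r -!EFinM lee_fin indicE.
case: (boolP (y + v \in _)); last first.
  by rewrite mul0r => _; rewrite mulr_ge0 ?exponential_pdf_ge0 ?divr_ge0 ?gw_ge0 ?ltW.
rewrite inE /= in_itv/= andbT ltrDr mul1r => y0.
rewrite (exponential_pdfE _ (ltW y0)) -mulrA (mulrA v^-1) mulVf ?gt_eqF// mul1r.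
rewrite /gw -expRD ler_expR.
have : 0 <= y ^+ 2 by rewrite sqr_ge0.
lra.
Qed.

Lemma bernoulli_ineq (x : R) n : 0 <= x -> 1 + n%:R * x <= (1 + x) ^+ n.
Proof.
move=> x0; elim: n => [|n IH]; first by rewrite mul0r addr0 expr0.
rewrite exprS -natr1; apply: (@le_trans _ _ ((1 + x) * (1 + n%:R * x))).
  have : 0 <= n%:R * x * x by rewrite !mulr_ge0.
  lra.
by rewrite ler_wpM2l// addr_ge0.
Qed.

(** The 16th power of 24/25 <= e^(-1/25). What counts is that e^(16/25)/2 is below 1: it is the
    ratio of a geometric decay in the dimension. *)
Lemma expR_16_25 : expR (16 / 25 : R) <= 2 * (100 / 104).
Proof.
rewrite -[leLHS]invrK -expRN.
have -> : - (16 / 25) = 16 * (- (1 / 25)) :> R by lra.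
rewrite expRM_natl.
have e1 : (24 / 25 : R) <= expR (- (1 / 25)).
  by rewrite (le_trans _ (expR_ge1Dx _))//; lra.
have e16 : (24 / 25 : R) ^+ 16 <= expR (- (1 / 25)) ^+ 16.
  by rewrite lerXn2r ?nnegrE ?expR_ge0//; lra.
have c16 : (52 / 100 : R) <= (24 / 25) ^+ 16 by lra.
rewrite (@le_trans _ _ (52 / 100)^-1)//; last by lra.
by rewrite lef_pV2 ?posrE ?exprn_gt0 ?expR_gt0//; lra.
Qed.

(** The relative cost of discarding short normals: e^(8n/25) is the price of the tilt, and the power
    of sqrt(1/2) compares the normalisations of e^(-|g|^2) and e^(-|g|^2/2) in dimension n - 1. The
    square of the product is 2 t^n with t <= 100/104. *)
Lemma small_ball_le n : (900 <= n)%N ->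
  expR (8 / 25 * n%:R) * Num.sqrt (2^-1 : R) ^+ n.-1 <= 10^-1.
Proof.
move=> n9; have n0 : (0 < n)%N by rewrite (leq_trans _ n9).
set A := expR _; set q := Num.sqrt _.
have q2 : q ^+ 2 = 2^-1 by rewrite sqr_sqrtr.
have q0 : 0 <= q by exact: sqrtr_ge0.
have A0 : 0 <= A by exact: expR_ge0.
rewrite -(@ler_pXn2r _ 2) ?nnegrE ?mulr_ge0 ?exprn_ge0//.
pose t : R := expR (16 / 25) / 2.
have t0 : 0 <= t by rewrite divr_ge0 ?expR_ge0.
have t1 : t <= 100 / 104 by rewrite /t ler_pdivrMr// [leRHS]mulrC expR_16_25.
have tE : (A * q ^+ n.-1) ^+ 2 = 2 * t ^+ n.
  rewrite exprMn -exprM mulnC exprM q2 -expRM_natl /t exprMn -expRM_natl.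
  have -> : 2 * (8 / 25 * n%:R) = n%:R * (16 / 25) :> R by lra.
  rewrite [in RHS]mulrCA; congr (_ * _).
  by rewrite -{2}(prednK n0) exprS mulrA divff ?mul1r.
(* Bernoulli at exponent 450 followed by squaring gives 2/361 <= 1/100; Bernoulli at 900 would give
   only 2/37. *)
have b : 19 <= (1 + 4 / 100 : R) ^+ 450.
  by apply: le_trans (bernoulli_ineq 450 _); lra.
pose c : R := (100 / 104) ^+ 450.
have c0 : 0 <= c by rewrite exprn_ge0//; lra.
have c1 : c * 19 <= 1.
  have cE : c * (1 + 4 / 100) ^+ 450 = 1.
    by rewrite /c -exprMn (_ : _ * _ = 1 :> R) ?expr1n//; lra.
  by rewrite -[leRHS]cE ler_wpM2l.
have tn : t ^+ n <= c ^+ 2.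
  rewrite /c -exprM (@le_trans _ _ (t ^+ 900))//.
    by rewrite ler_wiXn2l//; lra.
  by rewrite lerXn2r ?nnegrE//; lra.
have c2 : c ^+ 2 * 19 ^+ 2 <= 1.
  by rewrite -exprMn exprn_ile1// mulr_ge0.
by rewrite tE; lra.
Qed.

(** Normals of controlled length: the lower bound produces the factor sqrt n in the perimeter, and
    the upper bound limits how much a small displacement changes a constraint. *)
Definition shell n (L : R) : set 'rV[R]_n :=
  [set g | 4 / 5 * Num.sqrt n%:R <= enorm g <= L].

Arguments shell n L : clear implicits.

Lemma measurable_enorm n : measurable_fun setT (@enorm R n).
Proof.
apply: measurableT_comp.
  by apply: continuous_measurable_fun; exact: sqrt_continuous.
by apply: measurable_sum => i; apply: measurable_funX; exact: measurable_coord.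
Qed.

Lemma measurable_shell n L : measurable (shell n L).
Proof.
rewrite -[shell n L]setTI.
have := @measurable_enorm n measurableT (`[4 / 5 * Num.sqrt n%:R, L]%classic).
move=> /(_ (measurable_itv _)); congr (measurable (_ `&` _)).
Qed.

Section shell_estimate.
Variables (n : nat) (L : R).

(* Off the shell, tilting reduces the weight to Gaussian weights of other
   variances: e^{-|g|^2} for short g and e^{-|g|^2/4} for long g. *)
Lemma gwr_shell (g : 'rV[R]_n) : 0 <= L ->
  gwr 2^-1 g <= \1_(shell n L) g * gwr 2^-1 g
    + (expR (8 / 25 * n%:R) * gwr 1 g + expR (- (L ^+ 2 / 4)) * gwr 4^-1 g).
Proof.
move=> L0; rewrite indicE; case: (boolP (g \in _)) => [_|].
  by rewrite mul1r lerDl addr_ge0// mulr_ge0 ?expR_ge0.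
rewrite mul0r add0r notin_setE /shell/= => /negP; rewrite negb_and -!ltNge.
have K0 : 0 <= 4 / 5 * Num.sqrt (n%:R : R) by rewrite mulr_ge0 ?sqrtr_ge0//; lra.
have K2 : (4 / 5 * Num.sqrt (n%:R : R)) ^+ 2 = 16 / 25 * n%:R.
  by rewrite exprMn sqr_sqrtr//; lra.
case/orP => [gk|Lg].
  apply: (@le_trans _ _ (expR (8 / 25 * n%:R) * gwr 1 g)).
    rewrite /gwr -expRD ler_expR -sqr_enorm.
    have : enorm g ^+ 2 <= 16 / 25 * n%:R.
      by rewrite -K2 ler_pXn2r// ?nnegrE ?enorm_ge0// ltW.
    lra.
  by rewrite lerDl mulr_ge0 ?expR_ge0.
apply: (@le_trans _ _ (expR (- (L ^+ 2 / 4)) * gwr 4^-1 g)).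
  rewrite /gwr -expRD ler_expR -sqr_enorm.
  have : L ^+ 2 <= enorm g ^+ 2 by rewrite ler_pXn2r ?nnegrE ?enorm_ge0// ltW.
  lra.
by rewrite lerDr mulr_ge0 ?expR_ge0.
Qed.

End shell_estimate.

Lemma measurable_indic_dotr n (x : 'rV[R]_n) (A : set R) : measurable A ->
  measurable_fun setT (fun g => \1_A (dotr x g) : R).
Proof.
move=> mA; apply: measurableT_comp; first exact: measurable_indic.
exact: measurable_dotr.
Qed.

Lemma integral_itv_gwr (a : R) n (x : 'rV[R]_n) (A : set R) : 0 < a -> measurable A ->
  (\int[lebesgue_row n]_g ((\1_A (dotr x g) * gwr a g)%:E) =
   (gJ a ^+ n / gJ a)%:E * \int[leb]_y ((\1_A (enorm x * y)%R)%:E * (gw a y)%:E))%E.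
Proof.
move=> a0 mA; rewrite -(@integral_gwr_div a n x (fun t => (\1_A t)%:E))//.
by apply/measurable_EFinP; exact: measurable_indic.
Qed.

(** Start from the Gaussian mass of the whole slab, bounded below through the weight at v0. Short
    normals take away at most 1/10 of this bound and long ones at most 1/40, which leaves 7/8. The
    length L is fixed before x, u and v. *)
Lemma shell_lower n (r1 u0 v0 : R) : (900 <= n)%N -> 0 < r1 -> 0 < u0 ->
  v0 ^+ 2 <= 2 * u0 ^+ 2 ->
  exists2 L, 0 < L & forall (x : 'rV[R]_n) u v, r1 <= enorm x -> u0 <= u ->
    u <= v -> v <= v0 ->
   (((v - u) / (enorm x * J) * gw 2^-1 (v0 / enorm x) * (7 / 8))%:E <=
   \int[lebesgue_row n]_g
     (\1_(`]u, v[%classic) (dotr x g) * \1_(shell n L) g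
      * (gwr 2^-1 g / J ^+ n))%:E)%E.
Proof.
move=> n9 r10 u00 vu0.
have n0 : (0 < n)%N by rewrite (leq_trans _ n9).
have J0 : 0 < J by rewrite gJ_gt0.
pose q2 : R := Num.sqrt 2 ^+ n.-1.
have q20 : 0 < q2 by rewrite exprn_gt0// sqrtr_gt0.
(* [q2] compares the normalisations of e^(-|g|^2/4) and e^(-|g|^2/2) in dimension n - 1. The weight
   at v0/|x| is smallest at |x| = r1, so this [e] keeps the cost of long normals at 1/40 for all
   x. *)
pose e := gw 2^-1 (v0 / r1) / (40 * q2).
have e0 : 0 < e by rewrite divr_gt0 ?expR_gt0// mulr_gt0.
(* Then exp(- L^2/4) = exp(- 1/e), which is at most e because 1/e <= exp(1/e). *)
exists (Num.sqrt (4 / e)); first by rewrite sqrtr_gt0 divr_gt0.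
move=> x u v xr1 uu0 uv vv0.
set L := Num.sqrt _; set r := enorm x; set I : set R := `]u, v[%classic.
have L0 : 0 <= L by exact: sqrtr_ge0.
have eL : expR (- (L ^+ 2 / 4)) <= e.
  have -> : L ^+ 2 / 4 = e^-1.
    have e40 : 0 <= 4 / e by rewrite divr_ge0 ?(ltW e0).
    rewrite /L sqr_sqrtr//; field; by rewrite gt_eqF.
  rewrite expRN -[leRHS]invrK lef_pV2 ?posrE ?expR_gt0 ?invr_gt0//.
  by rewrite (le_trans _ (expR_ge1Dx _))// lerDr.
have r0 : 0 < r by exact: lt_le_trans xr1.
have u_ge0 : 0 <= u by rewrite (le_trans _ uu0)// ltW.
have mI : measurable I by exact: measurable_itv.
set X := (\int[_]_g _)%E.
pose F a g := (\1_I (dotr x g) * gwr a g) : R.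
have mF a : measurable_fun setT (fun g => (F a g)%:E).
  apply/measurable_EFinP/measurable_funM; last exact: measurable_gwr.
  exact: measurable_indic_dotr.
have F0 a g : (0 <= (F a g)%:E)%E by rewrite lee_fin mulr_ge0 ?gwr_ge0.
pose H g := (\1_I (dotr x g) * \1_(shell n L) g * (gwr 2^-1 g / J ^+ n)) : R.
have mH : measurable_fun setT (fun g => (H g)%:E).
  apply/measurable_EFinP/measurable_funM; last first.
    by apply: measurable_funM => //; exact: measurable_gwr.
  apply: measurable_funM; first exact: measurable_indic_dotr.
  by apply: measurable_indic; exact: measurable_shell.
have H0 g : (0 <= (H g)%:E)%E.
  by rewrite lee_fin !mulr_ge0 ?gwr_ge0 ?invr_ge0 ?exprn_ge0 ?(ltW J0).
have le1 : (\int[lebesgue_row n]_g (F 2^-1 g)%:E <=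
   (J ^+ n)%:E * X + ((expR (8 / 25 * n%:R))%:E * \int[lebesgue_row n]_g (F 1 g)%:E
     + (expR (- (L ^+ 2 / 4)))%:E * \int[lebesgue_row n]_g (F 4^-1 g)%:E))%E.
  have -> : X = (\int[lebesgue_row n]_g (H g)%:E)%E by [].
  rewrite -!ge0_integralZlT ?lee_fin ?expR_ge0 ?exprn_ge0 ?(ltW J0)//.
  have c0 a b g : (0 <= (expR b)%:E * (F a g)%:E)%E.
    by apply: mule_ge0; [rewrite lee_fin expR_ge0|exact: F0].
  have mc a b : measurable_fun setT (fun g => (expR b)%:E * (F a g)%:E)%E.
    exact: emeasurable_funM.
  have HJ0 g : (0 <= (J ^+ n)%:E * (H g)%:E)%E.
    by apply: mule_ge0; [rewrite lee_fin exprn_ge0// ltW|exact: H0].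
  have mHJ : measurable_fun setT (fun g => (J ^+ n)%:E * (H g)%:E)%E.
    exact: emeasurable_funM.
  rewrite -ge0_integralD// -ge0_integralD//; last 2 first.
  - by move=> g _; rewrite adde_ge0.
  - exact: emeasurable_funD.
  apply: ge0_le_integral => //.
    by apply: emeasurable_funD => //; exact: emeasurable_funD.
  move=> g _; rewrite -!EFinM -!EFinD lee_fin /F /H.
  have -> : J ^+ n * (\1_I (dotr x g) * \1_(shell n L) g * (gwr 2^-1 g / J ^+ n)) =
     \1_I (dotr x g) * (\1_(shell n L) g * gwr 2^-1 g).
    by field; rewrite expf_neq0 ?gt_eqF.
  have := gwr_shell g L0; rewrite [(\1_I _ : R)]indicE.
  by case: (_ \in I); rewrite ?mul1r// !mul0r !mulr0 !add0r.
pose D := (v - u) / r; pose G := gw 2^-1 (v0 / r).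
have D0 : 0 <= D by rewrite divr_ge0 ?subr_ge0 ?(ltW r0).
have vr0 : 0 <= v / r by rewrite divr_ge0 ?(ltW r0)// (le_trans u_ge0).
have s1 : ((J ^+ n / J * (D * G))%:E <= \int[lebesgue_row n]_g (F 2^-1 g)%:E)%E.
  rewrite integral_itv_gwr// [leLHS]EFinM; apply: lee_wpmul2l.
    by rewrite lee_fin divr_ge0 ?exprn_ge0 ?(ltW J0).
  have h0 : 0 < 2^-1 :> R by rewrite invr_gt0.
  apply: (le_trans _ (@integral_gw_itv_ge 2^-1 r u v h0 r0 u_ge0 uv)).
  rewrite lee_fin ler_wpM2l// gw_le//.
  by rewrite ler_pM2r// invr_gt0.
have s23 a c : 0 < a -> gw a (u / r) <= c ->
    (\int[lebesgue_row n]_g (F a g)%:E <= (gJ a ^+ n / gJ a * (D * c))%:E)%E.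
  move=> a0 ac; have Ja0 := gJ_gt0 a0.
  rewrite integral_itv_gwr// [leRHS]EFinM; apply: lee_wpmul2l.
    by rewrite lee_fin divr_ge0 ?exprn_ge0 ?(ltW Ja0).
  apply: (le_trans (@integral_gw_itv_le a r u v a0 r0 u_ge0 uv)).
  by rewrite lee_fin ler_wpM2l.
(* The hypothesis v0^2 <= 2 u0^2 bounds exp(-t^2) at u/r by exp(-t^2/2) at v0/r. *)
have s2 : (\int[lebesgue_row n]_g (F 1 g)%:E <= (gJ 1 ^+ n / gJ 1 * (D * G))%:E)%E.
  apply: s23 => //; rewrite /G /gw ler_expR lerN2 mul1r !expr_div_n.
  rewrite mulrA ler_pM2r ?invr_gt0 ?exprn_gt0//.
  have : u0 ^+ 2 <= u ^+ 2 by rewrite ler_pXn2r// nnegrE// ltW.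
  lra.
have s3 : (\int[lebesgue_row n]_g (F 4^-1 g)%:E <= (gJ 4^-1 ^+ n / gJ 4^-1 * (D * 1))%:E)%E.
  apply: s23; first by rewrite invr_gt0.
  by rewrite /gw -expR0 ler_expR oppr_le0 mulr_ge0// sqr_ge0.
have le2 := le_trans s1 (le_trans le1 (leeD (le_refl _)
  (leeD (lee_wpmul2l (_ : 0 <= (expR (8 / 25 * n%:R))%:E)%E s2)
        (lee_wpmul2l (_ : 0 <= (expR (- (L ^+ 2 / 4)))%:E)%E s3)))).
have {}le2 := le2 ltac:(by rewrite lee_fin expR_ge0) ltac:(by rewrite lee_fin expR_ge0).
have X0 : (0 <= X)%E by apply: integral_ge0 => g _; exact: H0.
clear le1 s1; case: X le2 X0 => [X'| |]; [|by move=> *; exact: leey|by []].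
rewrite -!EFinM -!EFinD !lee_fin => le2 X0.
have JE a q : 0 < a -> Num.sqrt (2 * a)^-1 = q -> gJ a ^+ n / gJ a = q ^+ n.-1 * (J ^+ n / J).
  move=> a0 aq; have Ja0 := gJ_gt0 a0.
  rewrite -(prednK n0) !exprSr !mulfK ?gt_eqF// (gJ_half a0) aq.
  by rewrite exprMn.
have J1 := JE 1 (Num.sqrt 2^-1) ltr01 ltac:(by rewrite mulr1).
have J4 := JE 4^-1 (Num.sqrt 2) ltac:(by rewrite invr_gt0) ltac:(by congr Num.sqrt; lra).
have sm := small_ball_le n9.
rewrite J1 J4 -/q2 in le2.
set A := expR (8 / 25 * n%:R) in le2 sm *; set B := expR _ in le2 eL *.
set q1 := Num.sqrt 2^-1 ^+ n.-1 in le2 sm *.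
have Bq2 : B * q2 <= G / 40.
  apply: (@le_trans _ _ (e * q2)); first by rewrite ler_pM2r.
  rewrite /e invfM mulrA mulfVK ?gt_eqF// ler_pM2r ?invr_gt0// /G gw_le ?divr_ge0 ?(ltW r0)//.
    by rewrite (le_trans u_ge0)// (le_trans uv).
  by rewrite ler_wpM2l ?lef_pV2 ?posrE// (le_trans u_ge0)// (le_trans uv).
have {}le2 : D * G <= J * X' + (A * q1 * (D * G) + B * q2 * D).
  have K0 : 0 < J ^+ n / J by rewrite divr_gt0 ?exprn_gt0.
  rewrite -(ler_pM2l K0); apply: le_trans le2 _.
  rewrite le_eqVlt; apply/orP; left; apply/eqP.
  by field; rewrite gt_eqF.
have DG0 : 0 <= D * G by rewrite mulr_ge0 ?gw_ge0.
have p1 : A * q1 * (D * G) <= 10^-1 * (D * G) by rewrite ler_wpM2r.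
have p2 : B * q2 * D <= G / 40 * D by rewrite ler_wpM2r.
have -> : (v - u) / (r * J) * G * (7 / 8) = D * G * (7 / 8) / J.
  by rewrite /D; field; rewrite !gt_eqF.
rewrite ler_pdivrMr// mulrC.
by move: p2 le2 p1; rewrite (mulrAC G) (mulrC G D); lra.
Qed.

(** Complement of the tail bound. As [gtail] can exceed 1, the maximum with 0 keeps the estimate
    nonnegative, so that it can be raised to powers. *)
Lemma halfspace_lower n (x : 'rV[R]_n) (rho : R) : 0 < rho -> 0 < enorm x ->
  ((Num.max 0 (1 - gtail (rho / enorm x)))%:E <=
   \int[lebesgue_row n]_g (\1_(`]-oo, rho]%classic) (dotr x g) * (gwr 2^-1 g / J ^+ n))%:E)%E.
Proof.
move=> rho0 x0; have h0 : 0 < 2^-1 :> R by rewrite invr_gt0.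
have J0 : 0 < J by rewrite gJ_gt0.
have w0 g : 0 <= gwr 2^-1 g / J ^+ n :> R.
  by rewrite divr_ge0 ?gwr_ge0 ?exprn_ge0 ?(ltW J0).
have mw : measurable_fun setT (fun g : 'rV[R]_n => gwr 2^-1 g / J ^+ n : R).
  by apply: measurable_funM => //; exact: measurable_gwr.
pose F A g : R := \1_A (dotr x g) * (gwr 2^-1 g / J ^+ n).
have F0 A g : (0 <= (F A g)%:E)%E by rewrite lee_fin mulr_ge0.
have mF A : measurable A -> measurable_fun setT (fun g => (F A g)%:E).
  move=> mA; apply/measurable_EFinP/measurable_funM => //.
  exact: measurable_indic_dotr.
have mle : measurable (`]-oo, rho]%classic : set R) by exact: measurable_itv.
have mgt : measurable (`]rho, +oo[%classic : set R) by exact: measurable_itv.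
have X0 : (0 <= \int[lebesgue_row n]_g (F `]-oo, rho]%classic g)%:E)%E.
  by apply: integral_ge0 => g _; exact: F0.
rewrite EFin_max ge_max X0/=.
have tail : (\int[lebesgue_row n]_g (F `]rho, +oo[%classic g)%:E <=
             (gtail (rho / enorm x))%:E)%E.
  under eq_integral do rewrite /F mulrA EFinM.
  rewrite ge0_integralZrT//; last 3 first.
  - apply/measurable_EFinP/measurable_funM; last exact: measurable_gwr.
    exact: measurable_indic_dotr.
  - by move=> g; rewrite lee_fin mulr_ge0 ?gwr_ge0.
  - by rewrite lee_fin invr_ge0 exprn_ge0// ltW.
  rewrite integral_itv_gwr// muleAC -EFinM.
  have -> : J ^+ n / J / J ^+ n = J^-1.
    by field; rewrite expf_neq0 gt_eqF.
  have -> : gtail (rho / enorm x) = J^-1 * (gw 2^-1 (rho / enorm x) / (rho / enorm x)).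
    by rewrite /gtail; field; rewrite !gt_eqF.
  rewrite EFinM lee_wpmul2l ?lee_fin ?invr_ge0 ?(ltW J0)//.
  rewrite (le_trans _ (integral_gw_tail _)) ?divr_gt0//.
  rewrite le_eqVlt; apply/orP; left; apply/eqP.
  apply: eq_integral => y _; congr ((_%:R)%:E * _)%E.
  apply: congr1; apply/idP/idP; rewrite !inE /= !in_itv/= !andbT ltr_pdivrMr// mulrC//.
have : (1 <= \int[lebesgue_row n]_g (F `]-oo, rho]%classic g)%:E +
   \int[lebesgue_row n]_g (F `]rho, +oo[%classic g)%:E)%E.
  rewrite -ge0_integralD//; last 2 first.
  - exact: mF.
  - exact: mF.
  have <- : (\int[lebesgue_row n]_g (gwr 2^-1 g / J ^+ n)%:E = 1)%E.
    under eq_integral do rewrite EFinM.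
    rewrite ge0_integralZrT; last 3 first.
    - by apply/measurable_EFinP; exact: measurable_gwr.
    - by move=> g; rewrite lee_fin gwr_ge0.
    - by rewrite lee_fin invr_ge0 exprn_ge0// ltW.
    by rewrite integral_gwr1// -EFinM divff// expf_neq0// gt_eqF.
  rewrite le_eqVlt; apply/orP; left; apply/eqP.
  apply: eq_integral => g _; rewrite -EFinD /F -mulrDl !indicE.
  rewrite !mem_setE !in_itv/= andbT leNgt.
  by case: ltP => _; rewrite ?add0r ?addr0 mul1r.
move=> /le_trans/(_ (leeD (le_refl _) tail)).
by rewrite EFinB leeBlDr.
Qed.

End gauss_estimates.

Arguments shell {R} n L.

(** * Averaging over independent choices *)

Section derandomization.
Context {d1 d2 : measure_display} {X : measurableType d1} {W : measurableType d2}
  {R : realType}.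
Variables (mu : probability X R) (nu : {sigma_finite_measure set W -> \bar R}).
Variables (w : W -> R) (a b : set (X * W)).
Hypotheses (mw : measurable_fun setT w) (w0 : forall g, 0 <= w g)
  (w1 : (\int[nu]_g (w g)%:E = 1)%E).
Hypotheses (ma : measurable a) (mb : measurable b) (ab0 : a `&` b = set0).

Fixpoint all_b (l : seq W) : set X :=
  if l is g :: l' then all_b l' `&` [set x | b (x, g)] else setT.

(* Exactly one condition of the list holds in the sense of a, all the others in
   the sense of b. *)
Fixpoint one_a (l : seq W) : set X :=
  if l is g :: l' then
    (one_a l' `&` [set x | b (x, g)]) `|` (all_b l' `&` [set x | a (x, g)])
  else set0.

Definition proba (c : set (X * W)) (x : X) : \bar R :=
  (\int[nu]_g ((\1_c (x, g) * w g)%:E))%E.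

Lemma measurable_slice (c : set (X * W)) g : measurable c ->
  measurable [set x | c (x, g)].
Proof.
move=> mc; rewrite (_ : [set x | _] = ysection c g); first exact: measurable_ysection.
by apply/seteqP; split => x; rewrite /ysection/= inE.
Qed.

Lemma measurable_all_b l : measurable (all_b l).
Proof. by elim: l => [|g l IH] //=; apply: measurableI => //; exact: measurable_slice. Qed.

Lemma measurable_one_a l : measurable (one_a l).
Proof.
elim: l => [|g l IH] //=; apply: measurableU; apply: measurableI => //;
  [exact: measurable_slice|exact: measurable_all_b|exact: measurable_slice].
Qed.

(** For fixed x and k independent vectors of density w, [pow_b] is the probability of [all_b] and
    [pow_a] that of [one_a]; the recursions are the same. *)
Fixpoint pow_b (k : nat) (x : X) : \bar R :=
  if k is k'.+1 then (proba b x * pow_b k' x)%E else 1%E.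

Fixpoint pow_a (k : nat) (x : X) : \bar R :=
  if k is k'.+1 then (proba b x * pow_a k' x + proba a x * pow_b k' x)%E else 0%E.

Let m1w c : measurable c ->
  measurable_fun setT (fun p : X * W => (\1_c p * w p.2)%:E).
Proof.
move=> mc; apply/measurable_EFinP/measurable_funM; first exact: measurable_indic.
exact: measurableT_comp.
Qed.

Let F0 c (p : X * W) : (0 <= (\1_c p * w p.2)%:E :> \bar R)%E.
Proof. by rewrite lee_fin mulr_ge0. Qed.

Lemma measurable_proba c : measurable c -> measurable_fun setT (proba c).
Proof.
move=> mc.
exact: (measurable_fun_fubini_tonelli_F (m2 := nu) _ (m1w mc) (F0 c)).
Qed.

Lemma proba_ge0 c x : (0 <= proba c x)%E.
Proof. by apply: integral_ge0 => g _; exact: (F0 c (x, g)). Qed.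

Lemma measurable_pow_b k : measurable_fun setT (pow_b k).
Proof.
elim: k => [|k IH] /=; first exact: measurable_cst.
by apply: emeasurable_funM => //; exact: measurable_proba.
Qed.

Lemma measurable_pow_a k : measurable_fun setT (pow_a k).
Proof.
elim: k => [|k IH] /=; first exact: measurable_cst.
apply: emeasurable_funD; apply: emeasurable_funM => //;
  [exact: measurable_proba|exact: measurable_proba|exact: measurable_pow_b].
Qed.

Lemma pow_b_ge0 k x : (0 <= pow_b k x)%E.
Proof. by elim: k => [|k IH] //=; rewrite mule_ge0 ?proba_ge0. Qed.

Lemma pow_a_ge0 k x : (0 <= pow_a k x)%E.
Proof.
by elim: k => [|k IH] //=; rewrite adde_ge0 ?mule_ge0 ?proba_ge0 ?pow_b_ge0.
Qed.

Lemma pow_b_ge (x : X) (B : R) k : 0 <= B -> (B%:E <= proba b x)%E ->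
  ((B ^+ k)%:E <= pow_b k x)%E.
Proof.
move=> B0 Bb; elim: k => [|k IH] //=.
by rewrite exprS EFinM lee_pmul ?lee_fin ?exprn_ge0.
Qed.

Lemma pow_a_ge (x : X) (A B : R) k : 0 <= A -> 0 <= B ->
  (A%:E <= proba a x)%E -> (B%:E <= proba b x)%E ->
  ((k.+1%:R * A * B ^+ k)%:E <= pow_a k.+1 x)%E.
Proof.
move=> A0 B0 Aa Bb; elim: k => [|k IH].
  by rewrite /= mule0 add0e mule1 expr0 mulr1 mul1r.
rewrite [pow_a _ _]/=.
have -> : k.+2%:R * A * B ^+ k.+1 = B * (k.+1%:R * A * B ^+ k) + A * B ^+ k.+1.
  by rewrite exprS -[k.+2%:R]natr1; ring.
rewrite EFinD EFinM [X in (_ + X)%E]EFinM leeD// lee_pmul ?lee_fin ?exprn_ge0 ?mulr_ge0 ?exprn_ge0//.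
exact: pow_b_ge.
Qed.

Local Open Scope ereal_scope.

Let G k l (x : X) : \bar R :=
  (\1_(one_a l) x)%:E * pow_b k x + (\1_(all_b l) x)%:E * pow_a k x.

Let mG k l : measurable_fun setT (G k l).
Proof.
apply: emeasurable_funD; apply: emeasurable_funM.
- by apply/measurable_EFinP; apply: measurable_indic; exact: measurable_one_a.
- exact: measurable_pow_b.
- by apply/measurable_EFinP; apply: measurable_indic; exact: measurable_all_b.
- exact: measurable_pow_a.
Qed.

Let G0 k l x : 0 <= G k l x.
Proof. by rewrite adde_ge0// mule_ge0 ?lee_fin ?pow_b_ge0 ?pow_a_ge0. Qed.

(** The integrand for the next vector g, with a and b tested on the pair (x, g): joint measurability
    is then visible and Tonelli applies. *)
Let H k l (p : X * W) : \bar R :=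
  ((\1_(one_a l) p.1)%:E * pow_b k p.1 + (\1_(all_b l) p.1)%:E * pow_a k p.1) *
     (\1_b p * w p.2)%:E +
  (\1_(all_b l) p.1)%:E * pow_b k p.1 * (\1_a p * w p.2)%:E.

(** Disjointness of a and b makes the union in [one_a] disjoint, so its indicator is a sum. *)
Let HE k l x g : H k l (x, g) = G k (g :: l) x * (w g)%:E.
Proof.
rewrite /H /G /= !EFinM !indicE.
have -> : ((x, g) \in a) = (x \in [set x | a (x, g)]) by apply/idP/idP; rewrite !inE.
have -> : ((x, g) \in b) = (x \in [set x | b (x, g)]) by apply/idP/idP; rewrite !inE.
rewrite in_setU !in_setI.
have : ~~ ((x \in [set x | a (x, g)]) && (x \in [set x | b (x, g)])).
  apply/negP => /andP[]; rewrite !inE /= => axg bxg.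
  by have : (a `&` b) (x, g) by []; rewrite ab0.
case: (x \in [set x | a (x, g)]); case: (x \in [set x | b (x, g)]) => // _;
  rewrite ?andbT ?andbF ?orbF ?orFb ?mul0e ?mule0 ?add0e ?adde0 ?mul1e ?mul0e//.
Qed.

Let mH k l : measurable_fun setT (H k l).
Proof.
have mT1 (f : X -> \bar R) : measurable_fun setT f ->
  measurable_fun setT (fun p : X * W => f p.1) by move=> mf; exact: measurableT_comp.
have m1 l' : measurable_fun setT (fun x : X => (\1_(one_a l') x)%:E : \bar R).
  by apply/measurable_EFinP; apply: measurable_indic; exact: measurable_one_a.
have m2 l' : measurable_fun setT (fun x : X => (\1_(all_b l') x)%:E : \bar R).
  by apply/measurable_EFinP; apply: measurable_indic; exact: measurable_all_b.
have m3 := measurable_pow_a; have m4 := measurable_pow_b.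
apply: emeasurable_funD; apply: emeasurable_funM.
- apply: emeasurable_funD.
    exact: (emeasurable_funM (mT1 _ (m1 l)) (mT1 _ (m4 k))).
  exact: (emeasurable_funM (mT1 _ (m2 l)) (mT1 _ (m3 k))).
- exact: m1w.
- exact: (emeasurable_funM (mT1 _ (m2 l)) (mT1 _ (m4 k))).
- exact: m1w.
Qed.

Let H0 k l p : 0 <= H k l p.
Proof.
by rewrite adde_ge0// ?mule_ge0 ?adde_ge0 ?mule_ge0 ?F0 ?lee_fin ?pow_b_ge0 ?pow_a_ge0.
Qed.

Let int_H k l x : \int[nu]_g H k l (x, g) = G k.+1 l x.
Proof.
have mx (f : X * W -> \bar R) : measurable_fun setT f ->
    measurable_fun setT (fun g => f (x, g)).
  by move=> mf; apply: (measurableT_comp mf); exact: measurable_pair1.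
have mcst c (f : W -> \bar R) : measurable_fun setT f ->
    measurable_fun setT (fun g => c * f g).
  by move=> mf; apply: emeasurable_funM.
have mb1 := mx _ (m1w mb); have ma1 := mx _ (m1w ma).
have c0 := pow_b_ge0 k x; have e0 := pow_a_ge0 k x.
have i0 A : 0 <= (\1_A x)%:E :> \bar R by rewrite lee_fin.
have u0 : 0 <= (\1_(all_b l) x)%:E * pow_b k x by exact: mule_ge0.
have v0 : 0 <= (\1_(one_a l) x)%:E * pow_b k x by exact: mule_ge0.
have z0 : 0 <= (\1_(all_b l) x)%:E * pow_a k x by exact: mule_ge0.
have s0 : 0 <= (\1_(one_a l) x)%:E * pow_b k x + (\1_(all_b l) x)%:E * pow_a k x.
  exact: adde_ge0.
have pb0 := proba_ge0 b x; have pa0 := proba_ge0 a x.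
rewrite ge0_integralD//; last 4 first.
- by move=> g _; rewrite mule_ge0.
- exact: (mcst ((\1_(one_a l) x)%:E * pow_b k x + (\1_(all_b l) x)%:E * pow_a k x) _ mb1).
- by move=> g _; rewrite mule_ge0.
- exact: (mcst ((\1_(all_b l) x)%:E * pow_b k x) _ ma1).
rewrite /= !ge0_integralZlT//.
rewrite -/(proba b x) -/(proba a x) ge0_muleDl// -addeA; congr (_ + _).
  by rewrite -muleA (muleC (pow_b _ _)).
have -> : pow_a k.+1 x = proba b x * pow_a k x + proba a x * pow_b k x by [].
rewrite (ge0_muleDr (_%:E)); [|exact: mule_ge0|exact: mule_ge0]; congr (_ + _).
  by rewrite -muleA (muleC (pow_a _ _)).
by rewrite -muleA (muleC (pow_b _ _)).
Qed.

(* The average over the vectors not yet chosen is computed one vector at a time: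
   with l already chosen, G k l is the conditional probability, over k further
   vectors, that exactly one condition holds in the sense of a. *)
Lemma derandomization_step k l (M : R) :
  (forall l', size l' = k -> mu (one_a (l' ++ l)) <= M%:E) ->
  \int[mu]_x G k l x <= M%:E.
Proof.
elim: k l => [|k IH] l hM.
  rewrite (_ : \int[mu]_x _ = mu (one_a l)); first exact: (hM [::]).
  transitivity (\int[mu]_x (\1_(one_a l) x)%:E).
    by apply: eq_integral => x _; rewrite /G /= mule1 mule0 adde0.
  by rewrite integral_indic ?setIT//; exact: measurable_one_a.
have le_g g : \int[mu]_x G k (g :: l) x <= M%:E.
  by apply: IH => l' kl; rewrite -cat_rcons; apply: hM; rewrite size_rcons kl.
have M0 : 0 <= M%:E.
  apply: le_trans (le_g (point : W)).
  by apply: integral_ge0 => x _; exact: G0.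
have GH : measurable_fun setT (fun g => \int[mu]_x H k l (x, g)).
  exact: (measurable_fun_fubini_tonelli_G (m1 := mu) _ (mH k l) (H0 k l)).
(* Averaging over k + 1 vectors is averaging over the next one, g, the averages over the other k; by
   induction each of these is at most M. *)
rewrite -[leLHS](_ : \int[nu]_g \int[mu]_x H k l (x, g) = _); last first.
  rewrite -(fubini_tonelli (m1 := mu) (m2 := nu) _ (mH k l) (H0 k l)).
  by apply: eq_integral => x _; exact: int_H.
rewrite -[leRHS]mule1 -w1 -ge0_integralZlT; last 3 first.
- exact/measurable_EFinP.
- by move=> g; rewrite lee_fin.
- exact: M0.
apply: ge0_le_integral => //.
- by move=> g _; apply: integral_ge0.
- apply: emeasurable_funM; first exact: measurable_cst.
  exact/measurable_EFinP.
move=> g _; under eq_integral do rewrite HE.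
rewrite ge0_integralZrT; last 3 first.
- exact: mG.
- exact: G0.
- by rewrite lee_fin.
by rewrite lee_wpmul2r// lee_fin.
Qed.

(** First-moment principle: the integral of [pow_a] is the mean of mu([one_a] l) over N independent
    vectors, so it cannot exceed a common bound. *)
Lemma derandomization (N : nat) (M : R) :
  (forall l, size l = N -> mu (one_a l) <= M%:E) ->
  \int[mu]_x pow_a N x <= M%:E.
Proof.
move=> hM; have := @derandomization_step N [::] M.
move=> /(_ (fun l' => _)).
under eq_integral do rewrite /G /= indic0 indicT mul0e add0e mul1e.
by apply => l' lN; rewrite cats0; exact: hM.
Qed.

End derandomization.

(** * Random polytopes *)

Section polytope.
Context {R : realType} {n : nat}.

Lemma measurable_dotr2 :
  measurable_fun setT (fun p : 'rV[R]_n * 'rV[R]_n => dotr p.1 p.2).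
Proof.
apply: measurable_sum => i; apply: measurable_funM.
  exact: measurableT_comp (measurable_coord i) measurable_fst.
exact: measurableT_comp (measurable_coord i) measurable_snd.
Qed.

Lemma measurable_halfspace (g : 'rV[R]_n) (rho : R) :
  measurable [set x | dotr x g <= rho].
Proof.
rewrite (_ : [set x | _] = [set: 'rV[R]_n] `&` dotr g @^-1` `]-oo, rho]%classic).
  by apply: measurable_dotr => //; exact: measurable_itv.
by rewrite setTI; apply/seteqP; split => x; rewrite /= in_itv/= dotrC.
Qed.

Variables (L rho0 rho rho' : R).

(** The levels are used with rho0 < rho < rho': a point in a slab lies just beyond one facet, while
    points of [halves] keep a margin rho - rho0 that absorbs a displacement. *)
Definition slabs : set ('rV[R]_n * 'rV[R]_n) :=
  [set p | rho < dotr p.1 p.2 < rho' /\ shell n L p.2].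

Definition halves : set ('rV[R]_n * 'rV[R]_n) := [set p | dotr p.1 p.2 <= rho0].

Lemma measurable_slabs : measurable slabs.
Proof.
rewrite (_ : slabs = ([set: 'rV[R]_n * 'rV[R]_n] `&`
    (fun p : 'rV[R]_n * 'rV[R]_n => dotr p.1 p.2) @^-1` `]rho, rho'[%classic) `&`
    ([set: 'rV[R]_n * 'rV[R]_n] `&` snd @^-1` shell n L)).
  apply: measurableI; first by apply: measurable_dotr2 => //; exact: measurable_itv.
  by apply: measurable_snd => //; exact: measurable_shell.
by rewrite !setTI; apply/seteqP; split => p; rewrite /slabs/= in_itv.
Qed.

Lemma measurable_halves : measurable halves.
Proof.
rewrite (_ : halves = [set: 'rV[R]_n * 'rV[R]_n] `&`
    (fun p : 'rV[R]_n * 'rV[R]_n => dotr p.1 p.2) @^-1` `]-oo, rho0]%classic).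
  by apply: measurable_dotr2 => //; exact: measurable_itv.
by rewrite setTI; apply/seteqP; split => p; rewrite /halves/= in_itv.
Qed.

(** Normals outside the shell impose no constraint, since a very long one could be violated after a
    small displacement. *)
Definition polytope (l : seq 'rV[R]_n) : set 'rV[R]_n :=
  [set y | forall g, g \in l -> shell n L g -> dotr y g <= rho].

Lemma measurable_polytope l : measurable (polytope l).
Proof.
elim: l => [|g l IH].
  by rewrite (_ : polytope [::] = setT)//; apply/seteqP; split.
rewrite (_ : polytope (g :: l) = polytope l `&`
  (if pselect (shell n L g) then [set x | dotr x g <= rho] else setT)).
  by apply: measurableI => //; case: pselect => ? /=; [exact: measurable_halfspace|].
apply/seteqP; split => [y Py|y [Py]].
  split; first by move=> h hl; apply: Py; rewrite inE hl orbT.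
  by case: pselect => //= gs; apply: Py => //; rewrite inE eqxx.
by case: pselect => //= gs yg h; rewrite inE => /predU1P[->//|]; exact: Py.
Qed.

Lemma convex_polytope l : convex_set (polytope l).
Proof.
rewrite convex_setE => x y t /andP[t0 t1] Px Py g gl gs.
rewrite dotrDl !dotrZl.
have := ler_wpM2l t0 (Px g gl gs).
have : (1 - t) * dotr y g <= (1 - t) * rho by rewrite ler_wpM2l ?subr_ge0//; exact: Py.
lra.
Qed.

Lemma all_bP l x : all_b halves l x <-> forall g, g \in l -> dotr x g <= rho0.
Proof.
elim: l => [|g l IH]; first by split.
split=> [[/IH H xg] h|H]; first by rewrite inE => /predU1P[->|/H].
split; first by apply/IH => h hl; apply: H; rewrite inE hl orbT.
by apply: H; rewrite inE eqxx.
Qed.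

Lemma one_aP l x : one_a slabs halves l x -> exists2 g, g \in l &
  slabs (x, g) /\ forall h, h \in l -> h != g -> dotr x h <= rho0.
Proof.
elim: l => [//|g l IH] /= [[/IH[h hl [sh H]] xg]|[/all_bP H xg]].
  exists h; first by rewrite inE hl orbT.
  split=> // h'; rewrite inE => /predU1P[-> //|]; exact: H.
exists g; first by rewrite inE eqxx.
split=> // h; rewrite inE => /predU1P[->|/H //]; by rewrite eqxx.
Qed.

(* Projecting the point on the only violated facet moves it by less than s, hence
   changes every other constraint by at most s * L. *)
Lemma one_a_sub s l : (0 < n)%N -> 0 <= s -> rho0 + s * L <= rho ->
  rho' <= rho + s * (4 / 5 * Num.sqrt n%:R) ->
  one_a slabs halves l `<=` nbhdU (polytope l) s `\` polytope l.
Proof.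
move=> n0 s0 sL sk x /one_aP[g gl [[/= /andP[xg xg'] gs] H]].
have /andP[kg gL] := gs.
have k0 : 0 < 4 / 5 * Num.sqrt n%:R :> R.
  by rewrite mulr_gt0 ?divr_gt0// sqrtr_gt0 ltr0n.
have g0 : 0 < enorm g by exact: lt_le_trans kg.
split; last by move=> /(_ g gl gs); rewrite leNgt xg.
pose t := (dotr x g - rho) / enorm g ^+ 2.
have t0 : 0 <= t by rewrite divr_ge0 ?exprn_ge0 ?enorm_ge0// subr_ge0 ltW.
have tg : t * enorm g < s.
  have -> : t * enorm g = (dotr x g - rho) / enorm g.
    by rewrite /t; field; rewrite gt_eqF.
  rewrite ltr_pdivrMr// ltrBlDl (lt_le_trans xg')// (le_trans sk)//.
  by rewrite lerD2l ler_wpM2l.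
right; exists (x - t *: g); last first.
  by rewrite opprB addrCA subrr addr0 enormZ ger0_norm.
move=> h hl hs; have /andP[_ hL] := hs.
rewrite dotrBl dotrZl; have [->|hg] := eqVneq h g.
  rewrite -sqr_enorm /t divfK ?expf_neq0 ?gt_eqF//; lra.
apply: le_trans sL; apply: lerD; first exact: H.
rewrite -mulrN (@le_trans _ _ (t * (enorm g * enorm h)))//.
  rewrite ler_wpM2l// (le_trans _ (_ : dotr (- g) h <= _))//.
    by rewrite -[- g]scaleN1r dotrZl mulN1r.
  by rewrite (le_trans (dotr_le _ _))// enormN.
rewrite mulrA; apply: ler_pM => //; last exact: ltW.
  exact: mulr_ge0 t0 (enorm_ge0 _).
exact: enorm_ge0.
Qed.

End polytope.

(** * Perimeter bound from random polytopes *)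

Section random_polytope.
Context {R : realType}.
Notation J := (gJ (2^-1 : R)).

(** With k + 1 random normals, the chance of crossing exactly one facet is at least 7/8 of c times
    the slab width. A distance s allows the width (4/5) sqrt n s, and 7/10 = (4/5)(7/8); the scale s
    cancels against [perimeter_growth]. *)
Lemma random_polytope n (mu : probability 'rV[R]_n R) k (rho0 rho1 r1 r2 c : R) :
  (900 <= n)%N -> 0 < rho0 -> rho0 < rho1 -> rho1 ^+ 2 <= 2 * rho0 ^+ 2 ->
  0 < r1 -> 0 <= c ->
  (forall r, r1 <= r <= r2 -> c <= k.+1%:R * (gw 2^-1 (rho1 / r) / (r * J)) *
     (Num.max 0 (1 - gtail (rho0 / r))) ^+ k) ->
  ((7 / 10 * Num.sqrt n%:R * c)%:E * mu [set x | (r1 <= enorm x <= r2)%R] <=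
    max_perimeter mu)%E.
Proof.
move=> n9 rho00 rho01 rho2 r10 c0 hc.
have := max_perimeter_ge0 mu.
case EM: (max_perimeter mu) => [M| |] //; last by move=> _; exact: leey.
rewrite lee_fin => M0.
have n0 : (0 < n)%N by rewrite (leq_trans _ n9).
have [L L0 hL] := shell_lower n9 r10 rho00 rho2.
pose ka : R := 4 / 5 * Num.sqrt n%:R.
have ka0 : 0 < ka by rewrite mulr_gt0 ?divr_gt0// sqrtr_gt0 ltr0n.
(* The margin s L and the slab width s ka together fill half of the gap, so rho and rho' stay
   between rho0 and rho1. *)
pose del := (rho1 - rho0) / 2.
have del0 : 0 < del by rewrite divr_gt0// subr_gt0.
pose s := del / (L + ka).
have s0 : 0 < s by rewrite divr_gt0// addr_gt0.
have sE : s * L + s * ka = del by rewrite -mulrDr divfK// gt_eqF// addr_gt0.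
have sL0 : 0 < s * L by rewrite mulr_gt0.
have sk0 : 0 < s * ka by rewrite mulr_gt0.
pose rho := rho0 + s * L; pose rho' := rho + s * ka.
have rho'1 : rho' <= rho1 by rewrite /rho' /rho -addrA sE /del; lra.
pose a := slabs (n := n) L rho rho'; pose b := halves (n := n) rho0.
pose w (g : 'rV[R]_n) : R := gwr 2^-1 g / J ^+ n.
have J0 : 0 < J by rewrite gJ_gt0.
have mw : measurable_fun setT w.
  by apply: measurable_funM => //; exact: measurable_gwr.
have w0 g : 0 <= w g by rewrite divr_ge0 ?gwr_ge0 ?exprn_ge0 ?(ltW J0).
have w1 : (\int[lebesgue_row n]_g (w g)%:E = 1)%E.
  under eq_integral do rewrite EFinM.
  rewrite ge0_integralZrT; last 3 first.
  - by apply/measurable_EFinP; exact: measurable_gwr.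
  - by move=> g; rewrite lee_fin gwr_ge0.
  - by rewrite lee_fin invr_ge0 exprn_ge0// ltW.
  by rewrite integral_gwr1 ?invr_gt0// -EFinM divff// expf_neq0// gt_eqF.
have ab0 : a `&` b = set0.
  rewrite -subset0 => -[x g] [[/= /andP[xg _] _]]; rewrite /b /halves/=.
  by rewrite leNgt (lt_trans _ xg)// ltrDl.
have ma := measurable_slabs (n := n) L rho rho'.
have mb := measurable_halves (n := n) rho0.
have := @derandomization _ _ _ _ R mu (lebesgue_row n) w a b mw w0 w1 ma mb ab0
  k.+1 (M * s).
have le_l l : (size l = k.+1 -> mu (one_a a b l) <= (M * s)%:E)%E.
  move=> _; apply: le_trans (_ : mu (nbhdU (polytope L rho l) s `\` polytope L rho l) <= _)%E.
    apply: le_measure; rewrite ?inE.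
    - exact: measurable_one_a.
    - by apply: measurableD; [apply: measurable_nbhdU|]; exact: measurable_polytope.
    - by apply: one_a_sub => //; exact: ltW.
  apply: perimeter_growth; [exact: convex_polytope|exact: measurable_polytope|exact: ltW|].
  by rewrite EM.
move=> /(_ le_l); set S := [set x | _].
have mS : measurable S.
  rewrite (_ : S = [set: 'rV[R]_n] `&` (@enorm R n) @^-1` `[r1, r2]%classic).
    by apply: measurable_enorm => //; exact: measurable_itv.
  by rewrite setTI; apply/seteqP; split => x; rewrite /S/= in_itv.
pose c' := s * ka * (7 / 8) * c.
have sk78 : 0 < s * ka * (7 / 8) by apply: mulr_gt0 => //; lra.
have c'0 : 0 <= c'.
  by apply: mulr_ge0 => //; apply: mulr_ge0; [exact: ltW|lra].
have pw x : S x -> (c'%:E <= pow_a (lebesgue_row n) w a b k.+1 x)%E.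
  move=> /[dup] Sx /andP[r1x xr2].
  have r0 : 0 < enorm x by exact: lt_le_trans r1x.
  pose A := (rho' - rho) / (enorm x * J) * gw 2^-1 (rho1 / enorm x) * (7 / 8).
  pose B := Num.max 0 (1 - gtail (rho0 / enorm x)).
  apply: le_trans (_ : ((k.+1%:R * A * B ^+ k)%:E <= _)%E).
    have := hc (enorm x); rewrite r1x xr2 => /(_ isT).
    rewrite -/B -(ler_pM2l sk78).
    rewrite lee_fin -/c' => /le_trans; apply.
    rewrite le_eqVlt; apply/orP; left; apply/eqP.
    by rewrite /A /rho' addrAC subrr add0r; field; rewrite !gt_eqF.
  apply: pow_a_ge.
  - rewrite /A /rho' addrAC subrr add0r; apply: mulr_ge0; last lra.
    apply: mulr_ge0; last exact: gw_ge0.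
    by apply: divr_ge0; [exact: ltW|exact: mulr_ge0 (enorm_ge0 _) (ltW J0)].
  - by rewrite le_max lexx.
  - have := hL x rho rho' r1x; rewrite lerDl (ltW sL0) lerDl (ltW sk0) rho'1.
    move=> /(_ isT isT isT); congr (_ <= _)%E.
    apply: eq_integral => g _; congr ((_ * _)%:E).
    rewrite -natrM mulnb; congr (_%:R); apply: congr1.
    apply/andP/idP => [[/set_mem + /set_mem gs]|/set_mem[xg gs]].
      by rewrite /= in_itv => xg; apply/mem_set.
    by split; apply/mem_set => //=; rewrite in_itv.
  - by have := halfspace_lower rho00 r0; congr (_ <= _)%E.
have lb : (c'%:E * mu S <= \int[mu]_x pow_a (lebesgue_row n) w a b k.+1 x)%E.
  rewrite -[S]setIT -integral_indic// -ge0_integralZlT//; last first.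
    by apply/measurable_EFinP; exact: measurable_indic.
  apply: ge0_le_integral => //.
  - by move=> x _; rewrite mule_ge0.
  - by apply: emeasurable_funM => //; apply/measurable_EFinP; exact: measurable_indic.
  - exact: measurable_pow_a.
  - move=> x _; rewrite indicE; case: (boolP (x \in S)) => [/set_mem Sx|_].
      by rewrite mule1 pw.
    by rewrite mule0 pow_a_ge0.
move=> /(le_trans lb).
have -> : c' = s * (7 / 10 * Num.sqrt n%:R * c).
  by rewrite /c' /ka; field.
by rewrite (mulrC M) (EFinM s M) (EFinM s) -muleA lee_pmul2l ?lte_fin.
Qed.

End random_polytope.

(** * Perimeter bound from balls *)

Section ball.
Context {R : realType} {n : nat}.

Lemma measurable_enorm_itv (I : interval R) :
  measurable [set x : 'rV[R]_n | enorm x \in I].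
Proof.
rewrite (_ : [set x | _] = [set: 'rV[R]_n] `&` (@enorm R n) @^-1` [set` I]).
  by apply: measurable_enorm => //; exact: measurable_itv.
by rewrite setTI.
Qed.

(** The annulus lies outside the ball of radius m - l but within distance 2 l of it; apply
    [perimeter_growth] at the scale 2 l. *)
Lemma annulus_perimeter (mu : probability 'rV[R]_n R) (m l p : R) :
  0 < l -> l <= m -> (p%:E <= mu [set x | (m - l < enorm x < m + l)%R])%E ->
  ((p / (2 * l))%:E <= max_perimeter mu)%E.
Proof.
move=> l0 lm hp; have := max_perimeter_ge0 mu.
case EM: (max_perimeter mu) => [M| |] //; last by move=> _; exact: leey.
move=> _; pose Q : set 'rV[R]_n := [set x | enorm x <= m - l].
have mQ : measurable Q.
  rewrite (_ : Q = [set x | enorm x \in `]-oo, m - l]]); first exact: measurable_enorm_itv.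
  by apply/seteqP; split => x; rewrite /Q/= in_itv.
have cQ : convex_set Q.
  rewrite convex_setE => x y t /andP[t0 t1] Qx Qy; rewrite /Q/=.
  rewrite (le_trans (enormD _ _))// !enormZ !ger0_norm ?subr_ge0//.
  have := ler_wpM2l t0 Qx.
  have : (1 - t) * enorm y <= (1 - t) * (m - l) by rewrite ler_wpM2l ?subr_ge0.
  lra.
have l2 : 0 < 2 * l by rewrite mulr_gt0.
have := perimeter_growth cQ mQ (ltW l2) (_ : (max_perimeter mu <= M%:E)%E).
rewrite EM => /(_ (lexx _)) gr.
rewrite lee_fin ler_pdivrMr// -lee_fin (le_trans hp)// (le_trans _ gr)//.
apply: le_measure; rewrite ?inE.
- rewrite (_ : [set x | _] = [set x | enorm x \in `]m - l, m + l[]).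
    exact: measurable_enorm_itv.
  by apply/seteqP; split => x; rewrite /= in_itv.
- by apply: measurableD => //; exact: measurable_nbhdU.
move=> x /= /andP[mlx xml]; split; last by apply/negP; rewrite -ltNge.
right; have ml0 : 0 <= m - l by rewrite subr_ge0.
have x0 : 0 < enorm x by exact: le_lt_trans mlx.
(* Radial projection on the ball; for m = l it is the origin. *)
exists (((m - l) / enorm x) *: x).
  by rewrite /Q/= enormZ ger0_norm ?divr_ge0 ?(ltW x0)// divfK// gt_eqF.
rewrite -{1}[x]scale1r -scalerBl enormZ ger0_norm; last first.
  by rewrite subr_ge0 ler_pdivrMr// mul1r ltW.
by rewrite mulrBl divfK ?gt_eqF// mul1r; lra.
Qed.

End ball.

(** * Choice of the parameters *)

Section numeric.
Context {R : realType}.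
Notation J := (gJ (2^-1 : R)).

Lemma sqr_gJ_half : J ^+ 2 = 2 * pi.
Proof. by rewrite /gJ sqr_sqrtr invrK mulrC// mulr_ge0// pi_ge0. Qed.

Lemma gJ_half_bounds : 2 <= J <= 3.
Proof.
have J0 : 0 < J by rewrite gJ_gt0.
have := pi_ge2 R; have /andP[_] := pihalf_02 R.
rewrite ltr_pdivrMr// => p4 p2; have := sqr_gJ_half.
move=> J2; apply/andP; split.
  by rewrite -(@ler_pXn2r _ 2) ?nnegrE ?(ltW J0)// J2; lra.
by rewrite -(@ler_pXn2r _ 2) ?nnegrE ?(ltW J0)// J2; lra.
Qed.

(** The k-th power of 1 + u <= e^u at u = - x/k; it reduces the numerical bounds below to rational
    arithmetic. *)
Lemma expRN_ge (x : R) k : (0 < k)%N -> x <= k%:R ->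
  (1 - x / k%:R) ^+ k <= expR (- x).
Proof.
move=> k0 xk; have kp : 0 < k%:R :> R by rewrite ltr0n.
have -> : - x = k%:R * (- (x / k%:R)) by field; rewrite gt_eqF.
rewrite expRM_natl lerXn2r ?nnegrE ?expR_ge0 ?expR_ge1Dx//.
by rewrite subr_ge0 ler_pdivrMr// mul1r.
Qed.

Lemma gtail_le (s t : R) : 0 < s -> s <= t -> gtail t <= gtail s.
Proof.
move=> s0 st; have J0 : 0 < J by rewrite gJ_gt0.
rewrite /gtail ler_pM ?gw_ge0 ?invr_ge0 ?mulr_ge0 ?(ltW J0) ?(le_trans (ltW s0))//.
  by apply: gw_le => //; exact: ltW.
have t0 : 0 < t by exact: lt_le_trans st.
by rewrite lef_pV2 ?posrE ?mulr_gt0// ler_pM2l.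
Qed.

(** From 1 - T >= exp(- T/(1 - T)), and k T/(1 - T) <= (k + 1) T exactly when (k + 1) T^2 <= T. *)
Lemma expR_le_pow (T : R) k : 0 <= T -> T < 1 -> k.+1%:R * T <= 1 ->
  expR (- (k.+1%:R * T)) <= (1 - T) ^+ k.
Proof.
move=> T0 T1 kT; have T1' : 0 < 1 - T by rewrite subr_gt0.
have e1 : expR (- (T / (1 - T))) <= 1 - T.
  rewrite expRN -[leRHS]invrK lef_pV2 ?posrE ?expR_gt0 ?invr_gt0//.
  apply: le_trans (expR_ge1Dx _).
  by rewrite le_eqVlt; apply/orP; left; apply/eqP; field; rewrite gt_eqF.
apply: (@le_trans _ _ (expR (- (T / (1 - T))) ^+ k)); last first.
  by rewrite lerXn2r ?nnegrE ?expR_ge0 ?(ltW T1').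
rewrite -expRM_natl ler_expR mulrN lerN2 mulrA ler_pdivrMr//.
have : (k.+1%:R * T) * T <= 1 * T by rewrite ler_wpM2r.
by rewrite -natr1; lra.
Qed.

(** Bound e^(-(y - y1)) below by 1 - (y - y1); what remains is (y - y1)(1 - y) >= 0. *)
Lemma mul_expRN_le (y1 y : R) : 0 <= y1 -> y1 <= y -> y <= 1 ->
  y1 * expR (- y1) <= y * expR (- y).
Proof.
move=> y10 y1y y1'.
have -> : - y = - y1 + - (y - y1) by ring.
rewrite expRD [leRHS]mulrCA [leLHS]mulrC ler_wpM2l ?expR_ge0//.
apply: (@le_trans _ _ (y * (1 + - (y - y1)))); last first.
  by rewrite ler_wpM2l ?expR_ge1Dx// (le_trans y10).
have : 0 <= (y - y1) * (1 - y) by rewrite mulr_ge0// subr_ge0.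
lra.
Qed.

Lemma expRN1_ge : 4^-1 <= expR (- 1 : R).
Proof. by apply: le_trans (@expRN_ge 1 2 isT _); lra. Qed.

Lemma expRN_8 : expR (- 8) <= 25^-1 :> R.
Proof.
rewrite expRN lef_pV2 ?posrE ?expR_gt0//.
have -> : 8 = 2%:R * 4 :> R by lra.
rewrite expRM_natl; apply: (@le_trans _ _ (5 ^+ 2)); first by lra.
by rewrite lerXn2r ?nnegrE ?expR_ge0// (le_trans _ (expR_ge1Dx _))//; lra.
Qed.

Lemma expRN_817 : 432 / 1000 <= expR (- (817 / 1000) : R).
Proof. by apply: le_trans (@expRN_ge _ 16 isT _); lra. Qed.

Lemma expRN_41 : 27 / 100 <= 41 / 100 * expR (- (41 / 100) : R).
Proof.
have := @expRN_ge (41 / 100) 16 isT ltac:(lra).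
lra.
Qed.

Lemma gtail_gt0 (v : R) : 0 < v -> 0 < gtail v.
Proof. by move=> v0; rewrite /gtail divr_gt0 ?expR_gt0// mulr_gt0// gJ_gt0. Qed.

Lemma gtail_small (v : R) : 4 <= v -> gtail v <= 1 / 100.
Proof.
move=> v4; have v0 : 0 < v by exact: lt_le_trans v4.
have J0 : 0 < J by rewrite gJ_gt0.
have /andP[J2 _] := gJ_half_bounds.
rewrite /gtail ler_pdivrMr ?mulr_gt0//; apply: (@le_trans _ _ (25^-1)).
  apply: le_trans expRN_8; rewrite ler_expR lerN2.
  have : 4 ^+ 2 <= v ^+ 2 by rewrite ler_pXn2r ?nnegrE ?(ltW v0).
  lra.
have : 2 * 4 <= J * v by apply: ler_pM.
lra.
Qed.

(** Take k + 1 to be the integer part of 1/T; rounding loses at most T. This gives the number of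
    facets. *)
Lemma exists_natmul_le1 (T : R) : 0 < T -> T <= 1 / 100 ->
  exists k, 99 / 100 <= k.+1%:R * T <= 1.
Proof.
move=> T0 T1; have Ti : 1 <= T^-1 by rewrite (invf_ge1 T0); lra.
exists (Num.trunc T^-1).-1.
have -> : (Num.trunc T^-1).-1.+1 = Num.trunc T^-1 by rewrite prednK// truncn_gt0.
have /andP[kle klt] : (Num.trunc T^-1)%:R <= T^-1 < (Num.trunc T^-1).+1%:R.
  by rewrite truncn_itv// invr_ge0 ltW.
have lo : 1 < (Num.trunc T^-1).+1%:R * T by rewrite -ltr_pdivrMr// div1r.
have hi : (Num.trunc T^-1)%:R * T <= 1 by rewrite -ler_pdivlMr// div1r.
rewrite hi andbT; move: lo; rewrite -[_.+1%:R]natr1; lra.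
Qed.

(* 41 / 99 is slightly below e^{-4/5} * (98 / 102), the limit of the ratio being
   e^{-4/5} as s / m tends to 0. *)
Lemma gtail_ratio (m s q : R) : 0 < s -> 100 * s <= m -> 0 < q ->
  q ^+ 2 = m / (5 * s) ->
  41 / 99 * gtail (m * q / (m + 2 * s)) <= gtail (m * q / (m - 2 * s)).
Proof.
move=> s0 sm q0 q2; have J0 : 0 < J by rewrite gJ_gt0.
have m0 : 0 < m by lra.
have r10 : 0 < m - 2 * s by lra.
have r20 : 0 < m + 2 * s by lra.
have r12 : (m + 2 * s) * (98 / 102) <= m - 2 * s by lra.
have rr0 : 0 < (m - 2 * s) * (m + 2 * s) by exact: mulr_gt0.
have r1r2 : m ^+ 2 / ((m - 2 * s) * (m + 2 * s)) <= 101 / 100.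
  rewrite ler_pdivrMr//.
  have : s ^+ 2 <= (m / 100) ^+ 2.
    by rewrite ler_pXn2r ?nnegrE ?divr_ge0 ?(ltW s0) ?(ltW m0)//; lra.
  have -> : (m - 2 * s) * (m + 2 * s) = m ^+ 2 - 4 * s ^+ 2 by ring.
  by have := sqr_ge0 m; rewrite expr_div_n; clear; lra.
have r1r20 : 0 <= m ^+ 2 / ((m - 2 * s) * (m + 2 * s)).
  by apply: divr_ge0; [exact: sqr_ge0|exact: ltW].
(* The difference of the exponents v^2/2 at the two radii; q^2 = m/(5 s) is chosen so that it stays
   near 4/5 however small s is. *)
pose E := 4 / 5 * (m ^+ 2 / ((m - 2 * s) * (m + 2 * s))) ^+ 2.
have E1 : E <= 817 / 1000.
  have : (m ^+ 2 / ((m - 2 * s) * (m + 2 * s))) ^+ 2 <= (101 / 100) ^+ 2.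
    have k0 : 0 <= 101 / 100 :> R by clear; lra.
    by rewrite ler_pXn2r ?nnegrE ?r1r20 ?k0.
  by rewrite /E; clear; lra.
have eE : 432 / 1000 <= expR (- E).
  by apply: (le_trans expRN_817); rewrite ler_expR lerN2.
have gwE : gw 2^-1 (m * q / (m - 2 * s)) = gw 2^-1 (m * q / (m + 2 * s)) * expR (- E).
  rewrite /gw -expRD; congr expR; rewrite !expr_div_n !exprMn q2 /E.
  by field; rewrite !gt_eqF.
have TE r : 0 < r -> gtail (m * q / r) = gw 2^-1 (m * q / r) * r / (J * (m * q)).
  by move=> r0; rewrite /gtail; field; rewrite !gt_eqF.
have K0 : 0 < (J * (m * q))^-1 by rewrite invr_gt0 !mulr_gt0.
rewrite !TE// gwE [leLHS]mulrA (ler_pM2r K0).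
have g0 : 0 < gw 2^-1 (m * q / (m + 2 * s)) by exact: expR_gt0.
rewrite mulrCA -(mulrA _ (expR (- E))) (ler_pM2l g0).
apply: (@le_trans _ _ (432 / 1000 * (m - 2 * s))); last by rewrite ler_pM2r.
by move: r12 m0 s0 sm; clear; lra.
Qed.

(* The number y = k.+1 * gtail (rho0 / r) stays in [41/100, 1], where
   y e^{-y} is increasing. *)
Lemma facet_density k (rho0 rho1 r1 r2 r : R) : 0 < rho0 -> 0 < r1 ->
  rho1 ^+ 2 = rho0 ^+ 2 + r1 ^+ 2 / 100 -> gtail (rho0 / r2) <= 1 / 100 ->
  99 / 100 <= k.+1%:R * gtail (rho0 / r2) <= 1 ->
  41 / 99 * gtail (rho0 / r2) <= gtail (rho0 / r1) ->
  r1 <= r <= r2 ->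
  rho0 / r2 ^+ 2 * (27 / 100) * (995 / 1000) <=
  k.+1%:R * (gw 2^-1 (rho1 / r) / (r * J)) * (Num.max 0 (1 - gtail (rho0 / r))) ^+ k.
Proof.
move=> rho00 r10 rho12 T2 /andP[NT2 NT1] Tr1 /andP[r1r rr2].
have J0 : 0 < J by rewrite gJ_gt0.
have r0 : 0 < r by exact: lt_le_trans r1r.
have r20 : 0 < r2 by exact: lt_le_trans rr2.
have Tr0 : 0 < gtail (rho0 / r) by rewrite gtail_gt0// divr_gt0.
have Trr2 : gtail (rho0 / r) <= gtail (rho0 / r2).
  by rewrite gtail_le ?divr_gt0// ler_pM2l// lef_pV2.
have Tr1r : gtail (rho0 / r1) <= gtail (rho0 / r).
  by rewrite gtail_le ?divr_gt0// ler_pM2l// lef_pV2.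
set T := gtail (rho0 / r) in Tr0 Trr2 Tr1r *; set N : R := k.+1%:R in NT1 NT2 *.
have N0 : 0 < N by rewrite ltr0n.
pose y := N * T.
have y1 : y <= 1 by rewrite (le_trans _ NT1)// ler_pM2l.
have y41 : 41 / 100 <= y.
  have : N * (41 / 99 * gtail (rho0 / r2)) <= y by rewrite ler_pM2l// (le_trans Tr1).
  by move: NT2; clear; lra.
have T1 : T <= 1 / 100 by exact: le_trans T2.
(* The chance that the k other constraints hold is about e^(-y). *)
have maxE : expR (- y) <= Num.max 0 (1 - T) ^+ k.
  apply: (le_trans (@expR_le_pow T k (ltW Tr0) _ y1)); first by move: T1; clear; lra.
  rewrite lerXn2r ?nnegrE ?le_max ?lexx ?orbT//.
  by move: T1; clear; lra.
(* Passing from rho0 to rho1 costs exp(- r1^2/(200 r^2)) >= 1 - 1/200. *)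
have gwr1 : 995 / 1000 * gw 2^-1 (rho0 / r) <= gw 2^-1 (rho1 / r).
  have -> : gw 2^-1 (rho1 / r) = expR (- (r1 ^+ 2 / r ^+ 2 / 200)) * gw 2^-1 (rho0 / r).
    rewrite /gw -expRD; congr expR; rewrite !expr_div_n rho12.
    by field; rewrite gt_eqF.
  rewrite ler_pM2r ?expR_gt0//; apply: le_trans (expR_ge1Dx _).
  have : r1 ^+ 2 / r ^+ 2 <= 1.
    rewrite ler_pdivrMr ?exprn_gt0// mul1r.
    by rewrite ler_pXn2r ?nnegrE ?(ltW r10) ?(ltW r0).
  by clear; lra.
(* Since [gtail] is phi(v)/v, the density is expressed exactly through y. *)
have yE : N * (gw 2^-1 (rho0 / r) / (r * J)) = y * (rho0 / r ^+ 2).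
  by rewrite /y /T /gtail; field; rewrite !gt_eqF.
have y0 : 0 < y by rewrite mulr_gt0.
have u0 : 0 < rho0 / r2 ^+ 2 by rewrite divr_gt0 ?exprn_gt0.
have c995 : 0 < 995 / 1000 :> R by clear; lra.
have fac : 995 / 1000 * (y * (rho0 / r2 ^+ 2)) <= N * (gw 2^-1 (rho1 / r) / (r * J)).
  apply: (@le_trans _ _ (995 / 1000 * (y * (rho0 / r ^+ 2)))).
    rewrite ler_pM2l// ler_pM2l// ler_pM2l// lef_pV2 ?posrE ?exprn_gt0//.
    by rewrite ler_pXn2r ?nnegrE ?(ltW r20) ?(ltW r0).
  by rewrite -yE mulrCA ler_pM2l// mulrA ler_pM2r// invr_gt0 mulr_gt0.
have ye := mul_expRN_le (ltac:(clear; lra) : 0 <= 41 / 100 :> R) y41 y1.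
apply: (@le_trans _ _ (995 / 1000 * (y * (rho0 / r2 ^+ 2)) * expR (- y))).
  have : rho0 / r2 ^+ 2 * (27 / 100) <= rho0 / r2 ^+ 2 * (y * expR (- y)).
    by rewrite ler_pM2l// (le_trans expRN_41).
  by clear; lra.
apply: ler_pM; [|exact: expR_ge0|exact: fac|exact: maxE].
by apply: mulr_ge0; [exact: ltW|apply: mulr_ge0; exact: ltW].
Qed.

(** As 0.447^2 < 1/5 and m + 2 s <= 1.02 m, the quotient m q/(m + 2 s)^2 is at least 0.429/sqrt(m
    s); and 0.7 times 0.429 times 0.27 times 0.995 times 0.75 exceeds 0.06. *)
Lemma thin_constant (m s q w : R) : 0 < s -> 0 < m -> 100 * s <= m -> 0 < q ->
  q ^+ 2 = m / (5 * s) -> 0 <= w ->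
  6 / 100 * (w / (Num.sqrt s * Num.sqrt m)) <=
  7 / 10 * w * (m * q / (m + 2 * s) ^+ 2 * (27 / 100) * (995 / 1000)) * (3 / 4).
Proof.
move=> s0 m0 sm q0 q2 w0; set a := Num.sqrt m; set b := Num.sqrt s.
have a0 : 0 < a by rewrite sqrtr_gt0.
have b0 : 0 < b by rewrite sqrtr_gt0.
have a2 : a ^+ 2 = m by rewrite sqr_sqrtr// ltW.
have b2 : b ^+ 2 = s by rewrite sqr_sqrtr// ltW.
have ab0 : 0 < a / b by rewrite divr_gt0.
have qab : 447 / 1000 * (a / b) <= q.
  have k0 : 0 <= 447 / 1000 * (a / b) by apply: mulr_ge0; [clear; lra|exact: ltW].
  rewrite -(@ler_pXn2r _ 2) ?nnegrE ?k0 ?(ltW q0)//.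
  rewrite exprMn (expr_div_n a b) a2 b2 q2 (_ : m / (5 * s) = 5^-1 * (m / s)); last first.
    by field; rewrite gt_eqF.
  by rewrite ler_pM2r ?divr_gt0//; clear; lra.
have u1 : 429 / 1000 / (b * a) <= m * q / (m + 2 * s) ^+ 2.
  apply: (@le_trans _ _ (m * (447 / 1000 * (a / b)) / ((102 / 100 * m) ^+ 2))).
    have -> : m * (447 / 1000 * (a / b)) / ((102 / 100 * m) ^+ 2) =
        447 / 1000 / (102 / 100) ^+ 2 / (b * a).
      by rewrite -a2; field; rewrite !gt_eqF.
    by rewrite ler_pM2r ?invr_gt0 ?mulr_gt0//; clear; lra.
  have k0 : 0 <= 447 / 1000 :> R by clear; lra.
  apply: ler_pM.
  - by apply: mulr_ge0; [exact: ltW|apply: mulr_ge0 => //; exact: ltW].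
  - by rewrite invr_ge0 sqr_ge0.
  - by rewrite ler_pM2l.
  - have r20 : 0 < m + 2 * s by move: m0 s0; clear; lra.
    have r2' : 0 < 102 / 100 * m by move: m0; clear; lra.
    rewrite lef_pV2 ?posrE ?exprn_gt0// ler_pXn2r ?nnegrE ?(ltW r20) ?(ltW r2')//.
    by move: sm; clear; lra.
have wu := ler_wpM2l w0 u1.
have ba0 : 0 <= w / (b * a) by apply: divr_ge0 => //; apply: mulr_ge0; exact: ltW.
by move: wu ba0; clear; lra.
Qed.

End numeric.

(** * Thick and thin shells *)

Section regimes.
Context {R : realType}.
Notation J := (gJ (2^-1 : R)).

Lemma max_perimeter_le n (mu : probability 'rV[R]_n R) (p c : R) (S : set 'rV[R]_n) : 0 <= c ->
  (p%:E <= mu S)%E -> (c%:E * mu S <= max_perimeter mu)%E ->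
  ((c * p)%:E <= max_perimeter mu)%E.
Proof. by move=> c0 pS; apply: le_trans; rewrite EFinM lee_wpmul2l// lee_fin. Qed.

(** One random half-space, at level rho0 = m - l with rho1 = sqrt 2 rho0. On the shell rho1/r <=
    sqrt 2, so the weight is at least e^(-1) >= 1/4; with r <= 2 m and J <= 3 this gives 1/(24
    m). *)
Lemma thick_shell n (mu : probability 'rV[R]_n R) (m l p : R) : (900 <= n)%N -> 0 < l -> l < m -> 0 <= p ->
  (p%:E <= mu [set x | (m - l <= enorm x <= m + l)%R])%E ->
  ((7 / 10 * Num.sqrt n%:R * (24 * m)^-1 * p)%:E <= max_perimeter mu)%E.
Proof.
move=> n9 l0 lm p0 hp.
have m0 : 0 < m by exact: lt_trans lm.
have r10 : 0 < m - l by rewrite subr_gt0.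
have J0 : 0 < J by rewrite gJ_gt0.
have /andP[J2 J3] := @gJ_half_bounds R.
pose rho1 := Num.sqrt 2 * (m - l).
have rho1E : rho1 ^+ 2 = 2 * (m - l) ^+ 2 by rewrite exprMn sqr_sqrtr.
have c0 : 0 <= (24 * m)^-1 by rewrite invr_ge0 mulr_ge0// ltW.
apply: (max_perimeter_le _ hp); first by rewrite mulr_ge0 ?mulr_ge0 ?sqrtr_ge0//; lra.
apply: (@random_polytope R n mu 0 (m - l) rho1) => //.
- rewrite -(@ltr_pXn2r _ 2) ?nnegrE ?mulr_ge0 ?sqrtr_ge0 ?(ltW r10)// rho1E.
  by rewrite ltr_pMl ?exprn_gt0// ltr1n.
- by rewrite rho1E.
move=> r /andP[r1r rr2]; rewrite expr0 mulr1 mul1r.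
have r0 : 0 < r by exact: lt_le_trans r1r.
have rm : r <= 2 * m by lra.
apply: (@le_trans _ _ (4^-1 * (2 * m * 3)^-1)).
  by rewrite le_eqVlt; apply/orP; left; apply/eqP; field; rewrite gt_eqF.
apply: ler_pM; rewrite ?invr_ge0 ?mulr_ge0 ?(ltW m0)//.
  apply: (le_trans expRN1_ge); rewrite ler_expR lerN2 expr_div_n rho1E mulrA.
  rewrite mulrA mulVf// mul1r ler_pdivrMr ?exprn_gt0// mul1r.
  by rewrite ler_pXn2r ?nnegrE ?(ltW r10) ?(ltW r0).
rewrite lef_pV2 ?posrE ?mulr_gt0//; apply: ler_pM => //; exact: ltW.
Qed.

Lemma thin_shell n (mu : probability 'rV[R]_n R) (m s : R) : 0 < s -> 100 * s <= m -> 9 * m < n%:R * s ->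
  ((3 / 4)%:E <= mu [set x | (m - 2 * s <= enorm x <= m + 2 * s)%R])%E ->
  ((6 / 100 * (Num.sqrt n%:R / (Num.sqrt s * Num.sqrt m)))%:E <= max_perimeter mu)%E.
Proof.
move=> s0 sm nms hp.
have m0 : 0 < m by lra.
have n9 : (900 <= n)%N.
  rewrite -(ler_nat R) -(ler_pM2r s0); apply: ltW; apply: le_lt_trans nms; lra.
have J0 : 0 < J by rewrite gJ_gt0.
have /andP[J2 J3] := @gJ_half_bounds R.
pose q := Num.sqrt (m / (5 * s)).
have q2 : q ^+ 2 = m / (5 * s).
  by rewrite sqr_sqrtr// divr_ge0 ?mulr_ge0 ?(ltW s0) ?(ltW m0).
have q220 : 20 <= q ^+ 2 by rewrite q2 ler_pdivlMr ?mulr_gt0//; lra.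
have q0 : 0 < q by rewrite sqrtr_gt0 divr_gt0// mulr_gt0.
pose r1 := m - 2 * s; pose r2 := m + 2 * s.
have r10 : 0 < r1 by rewrite /r1; lra.
have r12 : r1 <= r2 by rewrite /r1 /r2; lra.
have r20 : 0 < r2 by exact: lt_le_trans r12.
have r1m : 98 / 100 * m <= r1 by rewrite /r1; lra.
have r2m : r2 <= 102 / 100 * m by rewrite /r2; lra.
pose rho0 := m * q.
have rho00 : 0 < rho0 by rewrite mulr_gt0.
have rho02 : rho0 ^+ 2 = m ^+ 2 * q ^+ 2 by rewrite exprMn.
(* Above rho0, yet so close that the weight drops by at most a factor e^(-1/200) on the shell. *)
pose rho1 := Num.sqrt (rho0 ^+ 2 + r1 ^+ 2 / 100).
have r1sq : 0 < r1 ^+ 2 by rewrite exprn_gt0.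
have rho12 : rho1 ^+ 2 = rho0 ^+ 2 + r1 ^+ 2 / 100.
  by rewrite sqr_sqrtr// addr_ge0 ?sqr_ge0 ?divr_ge0 ?(ltW r1sq).
have msq : 0 < m ^+ 2 by rewrite exprn_gt0.
have r1sqm : r1 ^+ 2 <= m ^+ 2.
  by rewrite ler_pXn2r ?nnegrE ?(ltW r10) ?(ltW m0)// /r1; lra.
have mq20 : 20 * m ^+ 2 <= rho0 ^+ 2 by rewrite rho02 mulrC ler_pM2l.
(* Here rho0/r2 >= 4, since q^2 >= 20 and 16 (1.02)^2 < 20. *)
have T2 : gtail (rho0 / r2) <= 1 / 100.
  apply: gtail_small; rewrite ler_pdivlMr//.
  rewrite -(@ler_pXn2r _ 2) ?nnegrE ?(ltW rho00) ?mulr_ge0 ?(ltW r20)//.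
  apply: le_trans mq20; rewrite exprMn.
  have : r2 ^+ 2 <= (102 / 100 * m) ^+ 2.
    by rewrite ler_pXn2r ?nnegrE ?(ltW r20)// (le_trans _ r2m)// ltW.
  by move: msq; clear; lra.
have [k kT] := exists_natmul_le1 (gtail_gt0 (divr_gt0 rho00 r20)) T2.
have rat : 41 / 99 * gtail (rho0 / r2) <= gtail (rho0 / r1).
  exact: gtail_ratio.
pose c := rho0 / r2 ^+ 2 * (27 / 100) * (995 / 1000).
have c0 : 0 <= c.
  have u0 : 0 < rho0 / r2 ^+ 2 by rewrite divr_gt0 ?exprn_gt0.
  by rewrite /c; apply: mulr_ge0; [apply: mulr_ge0; [exact: ltW|]|]; clear; lra.
have hc r : r1 <= r <= r2 -> c <= k.+1%:R * (gw 2^-1 (rho1 / r) / (r * J)) *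
    (Num.max 0 (1 - gtail (rho0 / r))) ^+ k.
  exact: facet_density.
have rho01 : rho0 < rho1.
  rewrite -(@ltr_pXn2r _ 2) ?nnegrE ?sqrtr_ge0 ?(ltW rho00)// rho12 ltrDl.
  by rewrite divr_gt0.
have rho122 : rho1 ^+ 2 <= 2 * rho0 ^+ 2.
  by rewrite rho12; move: mq20 r1sqm msq; clear; lra.
have := @random_polytope R n mu k rho0 rho1 r1 r2 c n9 rho00 rho01 rho122 r10 c0 hc.
have w0 : 0 <= Num.sqrt n%:R :> R by exact: sqrtr_ge0.
move=> /(max_perimeter_le _ hp) H; apply: le_trans (H _); last first.
  by apply: mulr_ge0 => //; apply: mulr_ge0 => //; clear; lra.
by rewrite lee_fin; exact: thin_constant.
Qed.

End regimes.

(** * The constant and the case distinction *)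

Section main.
Context {R : realType}.

(** The second branch is proportional to 1 - alpha, the mass that Chebyshev's inequality leaves for
    a large spread. *)
Definition perimeter_const (alpha : R) : R :=
  if alpha <= 1 / 100 then 6 / 100 else (1 - alpha) / 600.

(** Here a^2 = m, b^2 = s and N = n: from n s <= 9 m follows w b <= 3 a, and 3 times 0.06 is below
    3/16. *)
Lemma small_spread_const (a b w N : R) : 0 < a -> 0 < b -> 0 <= w -> w ^+ 2 = N ->
  N * b ^+ 2 <= 9 * a ^+ 2 ->
  6 / 100 * (w / (b * a)) <= 3 / 4 / (2 * (2 * b ^+ 2)).
Proof.
move=> a0 b0 w0 wN Nb.
have wb : w * b <= 3 * a.
  rewrite -(@ler_pXn2r _ 2) ?nnegrE ?mulr_ge0 ?(ltW a0) ?(ltW b0)//.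
  by rewrite !exprMn wN; move: Nb; clear; lra.
have -> : 6 / 100 * (w / (b * a)) = 6 / 100 * (w * b) / (b ^+ 2 * a).
  by field; rewrite !gt_eqF.
have -> : 3 / 4 / (2 * (2 * b ^+ 2)) = 3 / 16 * a / (b ^+ 2 * a).
  by field; rewrite !gt_eqF.
rewrite ler_pM2r ?invr_gt0 ?mulr_gt0 ?exprn_gt0//.
by move: wb a0; clear; lra.
Qed.

Lemma large_spread_const (a b m s : R) : 0 < a -> 0 < b -> a ^+ 2 = m ->
  b ^+ 2 = s -> m <= 100 * s -> (b * a)^-1 <= 10 / m.
Proof.
move=> a0 b0 a2 b2 ms; have m0 : 0 < m by rewrite -a2 exprn_gt0.
have ab : m / 10 <= b * a.
  rewrite -(@ler_pXn2r _ 2) ?nnegrE ?mulr_ge0 ?(ltW a0) ?(ltW b0) ?(ltW m0)//.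
  rewrite [in leRHS]exprMn a2 b2 expr_div_n.
  have : m * m <= 100 * s * m by rewrite ler_pM2r.
  by clear; lra.
have -> : 10 / m = (m / 10)^-1 by field; rewrite gt_eqF.
by rewrite lef_pV2 ?posrE ?mulr_gt0.
Qed.

(** The number s stands for the standard deviation of |X|, and the last hypothesis is Chebyshev's
    inequality. *)
Lemma perimeter_const_bound n (mu : probability 'rV[R]_n R) (m s alpha : R) :
  0 < m -> 0 < s -> s <= alpha * m -> alpha < 1 ->
  (forall e : R, 0 < e ->
    ((1 - s ^+ 2 / e ^+ 2)%:E <= mu [set x | (m - e < enorm x < m + e)%R])%E) ->
  ((perimeter_const alpha * (Num.sqrt n%:R / (Num.sqrt s * Num.sqrt m)))%:E <=
   max_perimeter mu)%E.
Proof.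
move=> m0 s0 sam a1 H.
have alpha0 : 0 < alpha by rewrite -(pmulr_lgt0 _ m0) (lt_le_trans s0).
set w := Num.sqrt n%:R; set a := Num.sqrt m; set b := Num.sqrt s.
have a0 : 0 < a by rewrite sqrtr_gt0.
have b0 : 0 < b by rewrite sqrtr_gt0.
have w0 : 0 <= w by exact: sqrtr_ge0.
have a2 : a ^+ 2 = m by rewrite sqr_sqrtr// ltW.
have b2 : b ^+ 2 = s by rewrite sqr_sqrtr// ltW.
have w2 : w ^+ 2 = n%:R by rewrite sqr_sqrtr.
have q0 : 0 <= w / (b * a) by apply: divr_ge0 => //; apply: mulr_ge0; exact: ltW.
have Hc e : 0 < e ->
    ((1 - s ^+ 2 / e ^+ 2)%:E <= mu [set x | (m - e <= enorm x <= m + e)%R])%E.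
  move=> e0; apply: (le_trans (H e e0)); apply: le_measure; rewrite ?inE.
  - rewrite (_ : [set x | _] = [set x | enorm x \in `]m - e, m + e[]).
      exact: measurable_enorm_itv.
    by apply/seteqP; split => x; rewrite /= in_itv.
  - rewrite (_ : [set x | _] = [set x | enorm x \in `[m - e, m + e]]).
      exact: measurable_enorm_itv.
    by apply/seteqP; split => x; rewrite /= in_itv.
  - by move=> x /= /andP[xm mx]; rewrite !ltW.
have [sm|ms] := lerP (100 * s) m.
  apply: (@le_trans _ _ ((6 / 100 * (w / (b * a)))%:E)).
    rewrite lee_fin ler_wpM2r// /perimeter_const; case: ifP => // /negbT.
    by rewrite -ltNge; move: a1; clear; lra.
  have s20 : 0 < 2 * s by rewrite mulr_gt0.
  have s34 : 1 - s ^+ 2 / (2 * s) ^+ 2 = 3 / 4 by field; rewrite gt_eqF.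
  have [ns|ns] := lerP (n%:R * s) (9 * m).
    have sm2 : 2 * s <= m by move: sm m0 s0; clear; lra.
    have := annulus_perimeter s20 sm2 (H _ s20); apply: le_trans.
    rewrite lee_fin s34 -b2; apply: (small_spread_const a0 b0 w0 w2).
    by rewrite a2 b2.
  by apply: thin_shell => //; rewrite -s34; exact: Hc.
have a100 : 1 / 100 < alpha.
  by rewrite -(ltr_pM2r m0); move: ms sam; clear; lra.
have la0 : 0 < Num.sqrt alpha by rewrite sqrtr_gt0.
have la1 : Num.sqrt alpha < 1.
  by rewrite -(ltr_pXn2r (n := 2)) ?nnegrE ?(ltW la0)// sqr_sqrtr ?(ltW alpha0)// expr1n.
(* As s <= alpha m, this gives s^2/l^2 <= alpha, hence mass at least 1 - alpha, while l < m. *)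
pose l := Num.sqrt alpha * m.
have l0 : 0 < l by rewrite mulr_gt0.
have lm : l < m by rewrite gtr_pMl.
have l2 : l ^+ 2 = alpha * m ^+ 2 by rewrite exprMn sqr_sqrtr// ltW.
have pl : ((1 - alpha)%:E <= (1 - s ^+ 2 / l ^+ 2)%:E)%E.
  rewrite lee_fin lerD2l lerN2 ler_pdivrMr ?exprn_gt0// l2 mulrA -expr2 -exprMn.
  by rewrite ler_pXn2r ?nnegrE ?(ltW s0) ?mulr_ge0 ?(ltW alpha0) ?(ltW m0).
have ba := large_spread_const a0 b0 a2 b2 (ltW ms).
have b1 : 0 < 1 - alpha by rewrite subr_gt0.
rewrite /perimeter_const ifN -?ltNge//.
have step : (1 - alpha) / 600 * (w / (b * a)) <= (1 - alpha) * w / (60 * m).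
  have := ler_wpM2l (mulr_ge0 (ltW b1) w0) ba.
  have -> : (1 - alpha) * w / (60 * m) = (1 - alpha) * w * (10 / m) / 600.
    by field; rewrite gt_eqF.
  by clear; lra.
(* For n <= 900 the factor sqrt n is at most 30 and a ball is enough; beyond, one half-space gives
   7/240 >= 1/60. *)
have [n9|n9] := leqP n 900.
  have w30 : w <= 30.
    rewrite -(ler_pXn2r (n := 2)) ?nnegrE// w2.
    by rewrite (_ : 30 ^+ 2 = 900%:R) ?ler_nat//; clear; lra.
  have := annulus_perimeter l0 (ltW lm) (le_trans pl (H l l0)); apply: le_trans.
  rewrite lee_fin (le_trans step)//.
  apply: (@le_trans _ _ ((1 - alpha) / (2 * m))).
    have -> : (1 - alpha) / (2 * m) = (1 - alpha) * 30 / (60 * m).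
      by field; rewrite gt_eqF.
    by rewrite ler_pM2r ?invr_gt0 ?mulr_gt0// ler_pM2l.
  by rewrite ler_pM2l// lef_pV2 ?posrE ?mulr_gt0// ler_pM2l// ltW.
have := thick_shell (ltnW n9) l0 lm (ltW b1) (le_trans pl (Hc l l0)).
apply: le_trans; rewrite lee_fin (le_trans step)//.
have -> : 7 / 10 * Num.sqrt n%:R * (24 * m)^-1 * (1 - alpha) =
    (1 - alpha) * w / m * (7 / 240).
  by rewrite -/w; field; rewrite gt_eqF.
have -> : (1 - alpha) * w / (60 * m) = (1 - alpha) * w / m * (1 / 60).
  by field; rewrite gt_eqF.
rewrite ler_wpM2l//; last by clear; lra.
by apply: divr_ge0; [apply: mulr_ge0 => //; exact: ltW|exact: ltW].
Qed.

End main.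

Theorem theorem1p1 (R : realType) :
  exists C : R -> R,
    [/\ forall alpha : R, 0 <= alpha < 1 -> 0 < C alpha,
        C alpha @[alpha --> 0^'+] --> (6 / 100 : R),
        C alpha @[alpha --> 1^'-] --> (0 : R)
      & forall (n : nat) (d : measure_display) (T : measurableType d)
          (P : probability T R) (X : {RV P >-> 'rV[R]_n}) (alpha : R),
          (0 < n)%N ->
          distribution P X `<< lebesgue_row n ->
          ('E_P[enorm \o X] < +oo)%E ->
          0 <= alpha < 1 ->
          (sqrte 'V_P[enorm \o X] <= alpha%:E * 'E_P[enorm \o X])%E ->
          ((C alpha * (Num.sqrt n%:R
              / (fine 'V_P[enorm \o X] `^ 4^-1
                 * Num.sqrt (fine 'E_P[enorm \o X]))))%:E
           <= max_perimeter (distribution P X))%E ].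
Proof.
exists perimeter_const; split.
- move=> alpha /andP[a0 a1]; rewrite /perimeter_const; case: ifP => _.
    by rewrite divr_gt0.
  by rewrite divr_gt0 ?subr_gt0 ?ltr0n.
- have h : 0 < 1 / 100 :> R by rewrite divr_gt0.
  apply: cvg_near_cst; near=> a; rewrite /perimeter_const ifT//.
  by near: a; exact: nbhs_right_le.
- have lim : (fun a : R => (1 - a) / 600) a @[a --> 1^'-] --> (0 : R).
    rewrite [X in _ --> X](_ : 0 = (1 - 1) / 600 :> R); last by rewrite subrr mul0r.
    apply: cvg_at_left_filter; apply: cvgM; last exact: cvg_cst.
    by apply: cvgB; [exact: cvg_cst|exact: cvg_id].
  apply: cvg_trans lim; apply: near_eq_cvg.
  have h : 1 / 100 < 1 :> R by lra.
  near=> a; rewrite /perimeter_const ifN// -ltNge.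
  by near: a; exact: nbhs_left_gt.
move=> n d T P X alpha n0 _ Eoo /andP[alpha0 alpha1] VE.
have mY : measurable_fun setT (@enorm R n \o X).
  by apply: measurableT_comp => //; exact: measurable_enorm.
pose Ym := isMeasurableFun.Build _ _ _ _ (@enorm R n \o X) mY.
pose Y : {RV P >-> R} := HB.pack (@enorm R n \o X) Ym.
have EY : ('E_P[enorm \o X] = 'E_P[Y])%E by [].
have VY : ('V_P[enorm \o X] = 'V_P[Y])%E by [].
rewrite EY VY in VE Eoo *.
have E0 : (0 <= 'E_P[Y])%E by apply: expectation_ge0 => t; exact: enorm_ge0.
have mE : ('E_P[Y] = (fine 'E_P[Y])%:E)%E by rewrite fineK// ge0_fin_numE.
have m_ge0 : 0 <= fine ('E_P[Y])%E by exact: fine_ge0.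
have V0 := variance_ge0 P Y.
(* The variance is finite because its root is at most alpha times the finite mean. *)
have vE : ('V_P[Y] = (fine 'V_P[Y])%:E)%E.
  rewrite fineK// ge0_fin_numE//.
  move: VE; rewrite mE; case: ('V_P[Y])%E => [r| |] //= _; exact: ltry.
have v_ge0 : 0 <= fine ('V_P[Y])%E by exact: fine_ge0.
have cheb := @chebyshev _ _ _ P Y.
move: VE; rewrite vE mE -EFinM lee_fin => VE.
rewrite vE mE /= in cheb *.
set m := fine ('E_P[Y])%E in m_ge0 VE cheb *; set v := fine ('V_P[Y])%E in v_ge0 VE cheb *.
have -> : v `^ 4^-1 = Num.sqrt (Num.sqrt v).
  rewrite -!powR12_sqrt ?sqrtr_ge0// ?powR_ge0// -powRrM.
  by congr (v `^ _); rewrite -invfM -natrM.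
(* For v = 0 or m = 0 the quotient is 0, as the inverse of 0 is 0, and the claim is that the maximal
   perimeter is nonnegative. *)
have [->|v_neq0] := eqVneq v 0.
  by rewrite !sqrtr0 mul0r invr0 !mulr0 max_perimeter_ge0.
have [->|m_neq0] := eqVneq m 0.
  by rewrite !sqrtr0 mulr0 invr0 !mulr0 max_perimeter_ge0.
have v0 : 0 < v by rewrite lt_neqAle eq_sym v_neq0.
have m0 : 0 < m by rewrite lt_neqAle eq_sym m_neq0.
apply: perimeter_const_bound => //; first by rewrite sqrtr_gt0.
move=> e e0; rewrite sqr_sqrtr//.
set S := [set x | _].
(* The annulus is the complement of the deviation event that Chebyshev's inequality bounds by
   v/e^2. *)
have SE : X @^-1` S = ~` [set t | e <= `|Y t - m|].
  by apply/seteqP; split => t; rewrite /S /= -ltr_distl ltNge => /negP.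
rewrite [leRHS](_ : _ = P (X @^-1` S))// SE.
have mS : measurable [set t | e <= `|Y t - m|].
  have mYm : measurable_fun setT (fun t => `|Y t - m|).
    by apply: measurableT_comp => //; apply: measurable_funB.
  rewrite (_ : [set t | _] = [set: T] `&` (fun t => `|Y t - m|) @^-1` `[e, +oo[%classic).
    by apply: mYm => //; exact: measurable_itv.
  by rewrite setTI; apply/seteqP; split => t; rewrite /= in_itv/= andbT.
rewrite probability_setC// EFinB leeB//.
by rewrite (le_trans (cheb e e0))// -EFinM lee_fin mulrC.
Unshelve. all: by end_near.
Qed.
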